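(* Given the flow vorticity field $q_s(x)$, $s\in[t,T]$, consider the optimal control problem (MFG-1 model) $$\mathcal U(\rho,t)=\inf_{\rho(\cdot),\alpha(\cdot)}\left(\int G(x,q_T)\rho_T(x)\,dx+\int_t^T\int\left[L(\alpha_s(x))+F(x,q_s)\right]\rho_s(x)\,dx\,ds\right),$$ subject to $\partial_s\rho_s+\nabla\cdot[(\mathcal Tq_s+\alpha_s)\rho_s]=D\Delta\rho_s$ for $t\le s\le T$ and $\rho_t(x)=\rho(x)$, with $L(\alpha)=\frac12|\alpha|^2$. Then the optimal tracer density $\rho_s(x)$ is given by the solution $(\rho_s,\phi_s)$ of the MFG-1 system $$\partial_s\rho_s+\nabla\cdot[(\mathcal Tq_s+\nabla\phi_s)\rho_s]=D\Delta\rho_s,\quad t\le s\le T,\qquad \rho_t(x)=\rho(x),$$ $$\partial_s\phi_s+\tfrac12|\nabla\phi_s|^2+\nabla\phi_s\cdot\mathcal Tq_s+D\Delta\phi_s=F(x,q_s),\quad t\le s\le T,\qquad \phi_T(x)=-G(x,q_T),$$ and the corresponding optimal control is $\alpha_s(x)=\nabla\phi_s(x)$.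
   Context: The spatial domain is the torus $\mathbb T^d$ (with $d\le2$), all spatial integrals are over it, $D$ is the diffusion coefficient and $T$ is the terminal time. $\mathcal T$ is an (invertible) linear operator sending a scalar vorticity field $q$ to the velocity field $u=\mathcal Tq$, which is incompressible: $\nabla\cdot\mathcal Tq=0$. $\rho_s$ is the density of tracers, $\alpha_s$ is the (vector-valued) control field, $F(x,q)$ is the individual running cost and $G(x,q)$ the terminal cost; both may depend on the flow field $q$ locally or globally. No function spaces are specified; equations are understood in the classical sense. *)

(* Defs.v *)
From HB Require Import structures.
From mathcomp Require Import all_boot all_order all_algebra.
From mathcomp Require Import all_classical all_reals all_analysis.
Import Order.TTheory GRing.Theory Num.Theory.
Import numFieldNormedType.Exports.

Set Implicit Arguments.
Unset Strict Implicit.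
Unset Printing Implicit Defensive.

Local Open Scope classical_set_scope.
Local Open Scope ring_scope.

(* Functions on the torus (R / ell Z)^d are encoded as functions on R^d that
   are ell-periodic in each coordinate. *)
Definition on_torus (R : realType) (d : nat) (ell : R) (Y : zmodType)
    (f : 'rV[R]_d -> Y) : Prop :=
  forall i : 'I_d, periodic f (ell *: delta_mx 0 i).

(* Integral over the fundamental cell [0, ell]^d, as an iterated Lebesgue
   integral; the integrands below are continuous. *)
Fixpoint torus_integral (R : realType) (ell : R) (d : nat) :
    ('rV[R]_d -> R) -> R :=
  match d return ('rV[R]_d -> R) -> R with
  | 0 => fun f => f 0
  | d'.+1 => fun f =>
      \int[@lebesgue_measure R]_(x in `[0, ell])
        torus_integral ell (fun y : 'rV[R]_d' => f (row_mx (x%:M : 'M[R]_1) y))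
  end.

Definition pder (R : realType) (d : nat) (i : 'I_d) (f : 'rV[R]_d -> R) :
    'rV[R]_d -> R :=
  fun x => 'D_(delta_mx 0 i) f x.

Definition grad (R : realType) (d : nat) (f : 'rV[R]_d -> R)
    (x : 'rV[R]_d) : 'rV[R]_d :=
  \row_i pder i f x.

Definition divergence (R : realType) (d : nat) (v : 'rV[R]_d -> 'rV[R]_d)
    (x : 'rV[R]_d) : R :=
  \sum_(i < d) pder i (fun y => v y 0 i) x.

Definition laplacian (R : realType) (d : nat) (f : 'rV[R]_d -> R)
    (x : 'rV[R]_d) : R :=
  \sum_(i < d) pder i (pder i f) x.

Definition dotp (R : realType) (d : nat) (u v : 'rV[R]_d) : R :=
  \sum_(i < d) u 0 i * v 0 i.

(* |alpha|^2 is the Euclidean square dotp alpha alpha: the norm `|_| that the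
   library puts on 'rV[R]_d is the sup norm. *)
Definition lagrangian (R : realType) (d : nat) (alpha : 'rV[R]_d) : R :=
  2^-1 * dotp alpha alpha.

(* Time derivatives are taken along increments that stay in [t, T], hence are
   one-sided at t and at T. *)
Definition time_quotient (R : realType) (t T : R) (f : R -> R) (s : R) :
    set_system R :=
  (fun h : R => h^-1 * (f (s + h) - f s)) @
    within [set h | s + h \in `[t, T]] 0^'.

Definition time_derivable (R : realType) (t T : R) (f : R -> R) (s : R) :
    Prop :=
  cvg (time_quotient t T f s).

Definition time_deriv (R : realType) (t T : R) (f : R -> R) (s : R) : R :=
  lim (time_quotient t T f s).

Definition jointly_continuous (R : realType) (d : nat) (Y : topologicalType)
    (t T : R) (f : R -> 'rV[R]_d -> Y) : Prop :=
  {within `[t, T] `*` [set: 'rV[R]_d],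
    continuous (fun p : R * 'rV[R]_d => f p.1 p.2)}.

Definition C1_field (R : realType) (d : nat) (v : 'rV[R]_d -> 'rV[R]_d) :
    Prop :=
  continuous v /\
  forall i j : 'I_d,
    (forall x, derivable (fun y => v y 0 j) x (delta_mx 0 i)) /\
    continuous (pder i (fun y => v y 0 j)).

(* Class C^{1,2} on [t, T] x torus. *)
Record C12 (R : realType) (d : nat) (ell t T : R)
    (f : R -> 'rV[R]_d -> R) : Prop := MkC12 {
  C12_torus : forall s, s \in `[t, T] -> on_torus ell (f s);
  C12_cont : jointly_continuous t T f;
  C12_time : forall s x, s \in `[t, T] -> time_derivable t T (f ^~ x) s;
  C12_time_cont :
    jointly_continuous t T (fun s x => time_deriv t T (f ^~ x) s);
  C12_space : forall s x i, s \in `[t, T] ->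
    derivable (f s) x (delta_mx 0 i);
  C12_space_cont : forall i, jointly_continuous t T (fun s => pder i (f s));
  C12_space2 : forall s x i j, s \in `[t, T] ->
    derivable (pder i (f s)) x (delta_mx 0 j);
  C12_space2_cont : forall i j,
    jointly_continuous t T (fun s => pder j (pder i (f s)))
}.

(* The operator q |-> u, a linear bijection from a space V of vorticity fields
   onto a space W of velocity fields. The function Tau is only meaningful on V. *)
Record velocity_operator (R : realType) (d : nat) (ell : R)
    (V : set ('rV[R]_d -> R)) (W : set ('rV[R]_d -> 'rV[R]_d))
    (Tau : ('rV[R]_d -> R) -> ('rV[R]_d -> 'rV[R]_d)) : Prop :=
  MkVelocityOperator {
  vel_V_torus : forall f, V f -> on_torus ell f;
  vel_V0 : V (fun=> 0);
  vel_V_lin : forall (a : R) f g, V f -> V g -> V (fun x => a * f x + g x);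
  vel_W_torus : forall v, W v -> on_torus ell v;
  vel_W_C1 : forall v, W v -> C1_field v;
  vel_bij : set_bij V W Tau;
  vel_lin : forall (a : R) f g, V f -> V g ->
    Tau (fun x => a * f x + g x) = (fun x => a *: Tau f x + Tau g x);
  vel_div0 : forall f, V f -> forall x, divergence (Tau f) x = 0
}.

Definition transport_eq (R : realType) (d : nat) (D t T : R)
    (u alpha : R -> 'rV[R]_d -> 'rV[R]_d) (rho : R -> 'rV[R]_d -> R) : Prop :=
  forall s x, s \in `[t, T] ->
    time_deriv t T (rho ^~ x) s
      + divergence (fun y => rho s y *: (u s y + alpha s y)) x
    = D * laplacian (rho s) x.

Definition hjb_eq (R : realType) (d : nat) (D t T : R)
    (u : R -> 'rV[R]_d -> 'rV[R]_d) (f phi : R -> 'rV[R]_d -> R) : Prop :=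
  forall s x, s \in `[t, T] ->
    time_deriv t T (phi ^~ x) s
      + 2^-1 * dotp (grad (phi s) x) (grad (phi s) x)
      + dotp (grad (phi s) x) (u s x)
      + D * laplacian (phi s) x
    = f s x.

(* No sign condition is put on rho_s, s > t: only the initial datum is known to
   be a density. *)
Record mfg1_system (R : realType) (d : nat) (ell D t T : R)
    (Tau : ('rV[R]_d -> R) -> ('rV[R]_d -> 'rV[R]_d))
    (F G : 'rV[R]_d -> ('rV[R]_d -> R) -> R)
    (q : R -> 'rV[R]_d -> R) (rho0 : 'rV[R]_d -> R)
    (rho phi : R -> 'rV[R]_d -> R) : Prop := MkMFG1 {
  mfg1_rho_C12 : C12 ell t T rho;
  mfg1_phi_C12 : C12 ell t T phi;
  mfg1_transport :
    transport_eq D t T (fun s => Tau (q s)) (fun s => grad (phi s)) rho;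
  mfg1_init : forall x, rho t x = rho0 x;
  mfg1_hjb :
    hjb_eq D t T (fun s => Tau (q s)) (fun s x => F x (q s)) phi;
  mfg1_terminal : forall x, phi T x = - G x (q T)
}.

Record admissible (R : realType) (d : nat) (ell D t T : R)
    (Tau : ('rV[R]_d -> R) -> ('rV[R]_d -> 'rV[R]_d))
    (q : R -> 'rV[R]_d -> R) (rho0 : 'rV[R]_d -> R)
    (rho : R -> 'rV[R]_d -> R) (alpha : R -> 'rV[R]_d -> 'rV[R]_d) : Prop :=
  MkAdmissible {
  adm_rho_C12 : C12 ell t T rho;
  adm_rho_ge0 : forall s x, s \in `[t, T] -> 0 <= rho s x;
  adm_alpha_torus : forall s, s \in `[t, T] -> on_torus ell (alpha s);
  adm_alpha_C1 : forall s, s \in `[t, T] -> C1_field (alpha s);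
  adm_alpha_cont : jointly_continuous t T alpha;
  adm_transport : transport_eq D t T (fun s => Tau (q s)) alpha rho;
  adm_init : forall x, rho t x = rho0 x
}.

Definition cost (R : realType) (d : nat) (ell t T : R)
    (F G : 'rV[R]_d -> ('rV[R]_d -> R) -> R)
    (q : R -> 'rV[R]_d -> R)
    (rho : R -> 'rV[R]_d -> R) (alpha : R -> 'rV[R]_d -> 'rV[R]_d) : R :=
  torus_integral ell (fun x => G x (q T) * rho T x)
  + \int[@lebesgue_measure R]_(s in `[t, T])
      torus_integral ell
        (fun x => (lagrangian (alpha s x) + F x (q s)) * rho s x).

Definition value (R : realType) (d : nat) (ell D T : R)
    (Tau : ('rV[R]_d -> R) -> ('rV[R]_d -> 'rV[R]_d))
    (F G : 'rV[R]_d -> ('rV[R]_d -> R) -> R)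
    (q : R -> 'rV[R]_d -> R) (rho0 : 'rV[R]_d -> R) (t : R) : \bar R :=
  ereal_inf [set c : \bar R | exists rho alpha,
    admissible ell D t T Tau q rho0 rho alpha /\
    c = (cost ell t T F G q rho alpha)%:E].

Definition optimal (R : realType) (d : nat) (ell D t T : R)
    (Tau : ('rV[R]_d -> R) -> ('rV[R]_d -> 'rV[R]_d))
    (F G : 'rV[R]_d -> ('rV[R]_d -> R) -> R)
    (q : R -> 'rV[R]_d -> R) (rho0 : 'rV[R]_d -> R)
    (rho : R -> 'rV[R]_d -> R) (alpha : R -> 'rV[R]_d -> 'rV[R]_d) : Prop :=
  admissible ell D t T Tau q rho0 rho alpha /\
  (cost ell t T F G q rho alpha)%:E = value ell D T Tau F G q rho0 t.

(* Main.v *)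
(* For any admissible pair (rho', alpha'), differentiate the integral of
   phi_s rho'_s over the torus: inserting both equations and integrating by parts
   (Tau q_s + alpha' transports, D Delta is symmetric) gives
     cost (rho', alpha') = - int phi_t rho0
        + 1/2 int_t^T int |alpha' - grad phi|^2 rho'.
   Hence grad phi is optimal. A minimizer satisfies rho' alpha' = rho' grad phi,
   so rho' solves the same linear transport equation as rho, and the two agree by
   the minimum principle, which also gives rho >= 0. *)
Require Import Defs.
From HB Require Import structures.
From mathcomp Require Import all_boot all_order all_algebra.
From mathcomp Require Import all_classical all_reals all_analysis.
From mathcomp Require Import ring lra.
Import Order.TTheory GRing.Theory Num.Theory.
Import numFieldNormedType.Exports.
Local Open Scope classical_set_scope.
Local Open Scope ring_scope.

Set Implicit Arguments.
Unset Strict Implicit.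
Unset Printing Implicit Defensive.

(** * Continuity and periodicity *)

(** The fields are controlled on [[t, T]] only, and periodic functions live on a non-compact space.
    Clamping the time to [[t, T]] makes continuity unconditional, so that theorems on integrals with
    parameters apply; time derivatives are then needed at interior times only. Compactness comes
    from a closed cell, and periodicity carries its conclusions to all of R^d. No regularity in x or
    s is assumed of [F] and [G]. The Hamilton-Jacobi equation and the terminal condition express
    them through [phi], and this is how the cost densities become continuous. Continuity in turn is
    what allows a vanishing integral to be read pointwise. In nonconservative form the density
    equation has the zeroth-order coefficient Delta phi, whose sign is unknown; this forces an
    exponential weight in time in the minimum principle. Since [D = 0] is allowed, nothing rests on
    parabolic smoothing: uniqueness applies the weak principle to the difference of two densities,
    in both orders. *)

Lemma cvg_mx (R : realType) (I : Type) (F : set_system I) (FF : Filter F)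
    (m n : nat) (f : I -> 'M[R]_(m, n)) (l : 'M[R]_(m, n)) :
  (forall i j, f x i j @[x --> F] --> l i j) -> f @ F --> l.
Proof.
move=> fl; apply/cvgrPdist_lt => e e0.
have : \forall x \near F, forall ij : 'I_m * 'I_n, `|l ij.1 ij.2 - f x ij.1 ij.2| < e.
  apply: filter_forall => -[i j] /=.
  by move/cvgrPdist_lt : (fl i j); exact.
apply: filterS => x xe.
rewrite [ `|_|]mx_normrE; apply/bigmax_ltP; split => // ij _.
by rewrite !mxE; exact: xe.
Qed.

Lemma continuous_pair (P Q S : topologicalType) (f : P -> Q) (g : P -> S) :
  continuous f -> continuous g -> continuous (fun p => (f p, g p)).
Proof. by move=> cf cg p; exact: (cvg_pair (cf p) (cg p)). Qed.

Lemma continuous_compose (P Q S : topologicalType) (f : P -> Q) (g : Q -> S) :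
  continuous f -> continuous g -> continuous (fun p => g (f p)).
Proof. by move=> cf cg p; exact: (continuous_comp (cf p) (cg _)). Qed.

Lemma continuous_fst (P Q : topologicalType) : continuous (@fst P Q).
Proof. by move=> p; exact: (@cvg_fst _ _ (nbhs p.1) (nbhs p.2)). Qed.

Lemma continuous_snd (P Q : topologicalType) : continuous (@snd P Q).
Proof. by move=> p; exact: (@cvg_snd _ _ (nbhs p.1) (nbhs p.2)). Qed.

Lemma continuous_cst (P Q : topologicalType) (q : Q) : continuous (fun _ : P => q).
Proof. by move=> p; exact: cvg_cst. Qed.

(* f (clamp t T s) extends f continuously to all times, so that continuity within
   [t, T] becomes plain continuity. *)
Definition clamp (R : realType) (t T s : R) : R := Num.max t (Num.min s T).

Lemma clamp_in (R : realType) (t T s : R) : t <= T -> clamp t T s \in `[t, T].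
Proof.
by move=> tT; rewrite in_itv/= /clamp le_max lexx/= ge_max tT ge_min lexx orbT.
Qed.

Lemma clamp_id (R : realType) (t T s : R) : s \in `[t, T] -> clamp t T s = s.
Proof.
by rewrite in_itv/= /clamp => /andP[ts sT]; rewrite min_l// max_r.
Qed.

Lemma clamp_continuous (R : realType) (t T : R) : continuous (clamp t T).
Proof.
move=> s; apply: (@continuous_max R R (cst t) (id \min cst T)).
  exact: cvg_cst.
by apply: (@continuous_min R R id (cst T)); [exact: cvg_id|exact: cvg_cst].
Qed.

(** A clamped point never leaves the strip, so ordinary convergence of its arguments is already
    convergence along the [within] filter on which [jointly_continuous] is stated. *)
Lemma continuous_clamp (R : realType) (d : nat) (Y : topologicalType)
    (t T : R) (f : R -> 'rV[R]_d -> Y) : t <= T ->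
  jointly_continuous t T f ->
  continuous (fun p : R * 'rV[R]_d => f (clamp t T p.1) p.2).
Proof.
move=> tT /subspace_continuousP cf p.
have Ap (p' : R * 'rV[R]_d) : (`[t, T] `*` [set: 'rV[R]_d]) (clamp t T p'.1, p'.2).
  by split => //=; exact: clamp_in.
have c1 : clamp t T p'.1 @[p' --> p] --> clamp t T p.1.
  exact: (continuous_compose (@continuous_fst _ _) (@clamp_continuous R t T)).
have c2 : p'.2 @[p' --> p] --> p.2 by exact: continuous_snd.
have cc : (clamp t T p'.1, p'.2) @[p' --> p] -->
    within (`[t, T] `*` [set: 'rV[R]_d]) (nbhs (clamp t T p.1, p.2)).
  move=> U /= /(cvg_pair c1 c2); apply: (@filterS _ (nbhs p)) => p' /=; apply; exact: Ap.
exact: (@cvg_comp _ _ _ _ _ _ _ _ cc (cf _ (Ap p))).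
Qed.

(** Opposite faces are both kept: representatives are not unique, but the set is compact and meets
    every class modulo the periods. *)
Definition cell (R : realType) (ell : R) (d : nat) : set 'rV[R]_d :=
  [set x | forall i, `[0, ell]%classic (x ord0 i)].

Lemma cell_compact (R : realType) (ell : R) (d : nat) : compact (@cell R ell d).
Proof.
by apply: (@rV_compact R d (fun=> `[0, ell]%classic)) => i; exact: segment_compact.
Qed.

Lemma cell0 (R : realType) (ell : R) (d : nat) : 0 <= ell -> @cell R ell d 0.
Proof. by move=> l0 i; rewrite /= in_itv/= mxE lexx l0. Qed.

Lemma periodicz (U V : zmodType) (f : U -> V) (p : U) : periodic f p ->
  forall (z : int) x, f (x + p *~ z) = f x.
Proof.
move=> fp [n|n] x; first exact: periodicn.
by rewrite NegzE mulrNz -[LHS](periodicn fp n.+1) subrK.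
Qed.

(** Removing [floor (x_i / ell)] periods from each coordinate works for all periodic functions at
    once, so [y] is chosen before [f] and its codomain. *)
Lemma cell_repr (R : realType) (ell : R) (d : nat) (x : 'rV[R]_d) : 0 < ell ->
  exists2 y, cell ell y &
    forall (Y : zmodType) (f : 'rV[R]_d -> Y), on_torus ell f -> f x = f y.
Proof.
move=> l0.
pose z i := Num.floor (x 0 i / ell).
exists (x - \sum_(i < d) (ell *: delta_mx 0 i) *~ z i).
  move=> i /=; rewrite in_itv/=.
  have -> : (x - \sum_(i < d) (ell *: delta_mx 0 i) *~ z i) 0 i
      = x 0 i - ell * (z i)%:~R.
    rewrite !mxE; congr (_ - _).
    rewrite summxE (bigD1 i)//= big1 ?addr0.
      by rewrite -scaler_int !mxE !eqxx mulr1 mulrC.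
    by move=> j ji; rewrite -scaler_int !mxE eqxx/= eq_sym (negbTE ji) !mulr0.
  have /andP[h1 h2] := floor_itv (x 0 i / ell).
  rewrite subr_ge0 lerBlDl mulrC -ler_pdivlMr// h1/=.
  rewrite -[X in _ + X]mul1r -mulrDl -ler_pdivrMr//.
  by rewrite ltW// -[1]/(1%:~R) -intrD.
move=> Y f ft; rewrite -sumrN.
elim: (index_enum 'I_d) => [|i s IHs]; first by rewrite big_nil addr0.
by rewrite big_cons addrCA addrC -mulrNz (periodicz (ft i)).
Qed.

Lemma periodic_pder (R : realType) (d : nat) (f : 'rV[R]_d -> R) p i :
  periodic f p -> periodic (pder i f) p.
Proof.
move=> fp x; rewrite /pder /derive; do 2 f_equal.
by apply/funext => h /=; rewrite fp addrA fp.
Qed.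

Lemma is_derive_pder (R : realType) (d : nat) (f : 'rV[R]_d -> R) i x :
  derivable f x (delta_mx 0 i) -> is_derive x (delta_mx 0 i) f (pder i f x).
Proof. exact: derivableP. Qed.

(** The two difference quotients coincide. This is the bridge to one-variable calculus: the
    fundamental theorem and the extremum tests are applied along coordinate lines. *)
Lemma is_derive_line (R : realType) (d : nat) (f : 'rV[R]_d -> R) x v (h : R) :
  derivable f (h *: v + x) v ->
  is_derive h (1 : R) (fun k => f (k *: v + x)) ('D_v f (h *: v + x)).
Proof.
move=> df.
have E : (fun k : R => k^-1 *: (f ((k *: 1 + h) *: v + x) - f (h *: v + x)))
  = (fun k : R => k^-1 *: (f (k *: v + (h *: v + x)) - f (h *: v + x))).
  by apply/funext => k; rewrite scalerDl -addrA /GRing.scale/= mulr1.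
by apply: DeriveDef; rewrite /derivable/derive/= ?E.
Qed.

(** * Integration over the torus *)

Lemma continuous_integrable_itv (R : realType) (f : R -> R) (a b : R) :
  continuous f -> lebesgue_measure.-integrable `[a, b] (EFin \o f).
Proof.
move=> cf; apply: continuous_compact_integrable; first exact: segment_compact.
exact: continuous_subspaceT.
Qed.

Lemma Rintegral_cst_itv (R : realType) (a b c : R) : a <= b ->
  \int[@lebesgue_measure R]_(_ in `[a, b]) c = c * (b - a).
Proof.
move=> ab; rewrite Rintegral_cst//= lebesgue_measure_itv/= lte_fin.
by move: ab; rewrite le_eqVlt => /predU1P[->|->//]; rewrite ltxx subrr.
Qed.

(** By compactness of [[a, b]], [f (q, s)] is close to [f (p, s)] uniformly in [s] once [q] is near
    [p]. The parameter space is arbitrary because the induction in [torus_integral_continuous]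
    replaces [P] by [P * R]. *)
Lemma continuous_Rintegral (R : realType) (P : topologicalType)
    (f : P * R -> R) (a b : R) : a <= b -> continuous f ->
  continuous (fun p => \int[@lebesgue_measure R]_(s in `[a, b]) f (p, s)).
Proof.
move=> ab cf p.
have cfp q : continuous (fun s => f (q, s)).
  move=> s; apply: (continuous_comp (f := fun s => (q, s))); last exact: cf.
  by apply: continuous_pair => x; [exact: cvg_cst|exact: cvg_id].
apply/cvgrPdist_lt => e e0.
(* The [+ 1] keeps the denominator positive when [a = b] and the final bound strictly below [e]. *)
pose e' := e / (b - a + 1).
have ba0 : 0 < b - a + 1 by rewrite ltr_wpDl// subr_ge0.
have e'0 : 0 < e' by rewrite divr_gt0.
have /compact_near_coveringP cov := @segment_compact _ a b.
have H : \forall q \near p, `[a, b] `<=` (fun s => `|f (p, s) - f (q, s)| < e').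
  apply: cov => s _.
  have e2 : 0 < e' / 2 by rewrite divr_gt0.
  have /cvgrPdist_lt/(_ _ e2) h1 := cf (p, s).
  have /cvgrPdist_lt/(_ _ e2) h2 := cfp p s.
  have h1' : \forall x' \near s & i \near p, `|f (p, s) - f (i, x')| < e' / 2.
    case: h1 => -[A B] [/= pA sB] AB.
    exists (B, A) => // -[x' i] [/= Bx Ai]; exact: (AB (i, x')).
  have h2' : \forall x' \near s & i \near p, `|f (p, s) - f (p, x')| < e' / 2.
    exists ([set x' | `|f (p, s) - f (p, x')| < e' / 2], setT).
      by split => //=; exact: filterT.
    by move=> [x' i] [].
  apply: filterS2 h1' h2' => -[x' i] /= H1 H2.
  rewrite (splitr e') -[X in `|X|](subrKA (f (p, s)))
    (le_lt_trans (ler_normD _ _))// addrC ltrD// distrC.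
  exact: H2.
apply: filterS H => q Hq.
rewrite -RintegralB//; [|exact: continuous_integrable_itv..].
have cpq : continuous (fun s => f (p, s) - f (q, s)).
  by move=> s; apply: cvgB; exact: cfp.
apply: le_lt_trans (le_normr_Rintegral _ _) _ => //.
  exact: continuous_integrable_itv.
apply: (@le_lt_trans _ _ (\int[lebesgue_measure]_(s in `[a, b]) e')).
  apply: le_Rintegral => //.
  - by apply: continuous_integrable_itv => s; apply: cvg_norm; exact: cpq.
  - by apply: continuous_integrable_itv => s; exact: cvg_cst.
  - by move=> s /Hq /ltW.
rewrite Rintegral_cst_itv// /e' mulrAC ltr_pdivrMr// ltr_pM2l//.
by rewrite ltrDl.
Qed.

Lemma Rintegral_itv_eq0 (R : realType) (f : R -> R) (a b : R) : a < b ->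
  continuous f -> (forall s, s \in `[a, b] -> 0 <= f s) ->
  \int[@lebesgue_measure R]_(s in `[a, b]) f s = 0 ->
  forall s, s \in `[a, b] -> f s = 0.
Proof.
move=> ab cf f0 intf0 x xab; apply/eqP; rewrite eq_le f0// andbT leNgt.
apply/negP => fx0.
have fx2 : f x / 2 < f x by rewrite ltr_pdivrMr// ltr_pMr// ltr1n.
have /nbhs_ballP[r /= r0 rf] : \forall y \near x, f x / 2 < f y.
  exact: (cvgr_gt _ (cf x) _ fx2).
(* Half the radius keeps the closed interval [[c, e]] inside the open ball where [f] exceeds
   [f x / 2]. Since [a < b], it has positive length even when [x] is an endpoint. *)
pose c := Num.max a (x - r / 2); pose e := Num.min b (x + r / 2).
have /andP[ax xb] : a <= x <= b by move: xab; rewrite in_itv.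
have ce : c < e.
  by rewrite /c /e gt_max !lt_min ab/=; apply/and3P; split; lra.
have sub : `[c, e] `<=` `[a, b].
  by apply: subset_itv; rewrite bnd_simp /c /e ?le_max ?ge_min lexx.
have int_le : \int[lebesgue_measure]_(s in `[c, e]) f s
    <= \int[lebesgue_measure]_(s in `[a, b]) f s.
  apply: fine_le.
  - by apply: integrable_fin_num => //; exact: continuous_integrable_itv.
  - by apply: integrable_fin_num => //; exact: continuous_integrable_itv.
  apply: ge0_subset_integral => //.
  by apply: (measurable_int lebesgue_measure); exact: continuous_integrable_itv.
have : \int[lebesgue_measure]_(s in `[c, e]) (f x / 2)
    <= \int[lebesgue_measure]_(s in `[c, e]) f s.
  apply: le_Rintegral => //.
  - by apply: continuous_integrable_itv => s; exact: cvg_cst.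
  - exact: continuous_integrable_itv.
  move=> s /=; rewrite in_itv/= => /andP[cs se]; apply/ltW/rf => /=.
  move: cs se; rewrite /c /e ge_max le_min => /andP[_ cs] /andP[_ se].
  clear int_le; rewrite /ball/= ltr_norml; apply/andP; split; lra.
rewrite Rintegral_cst_itv; last exact: ltW.
move=> /le_trans/(_ int_le); rewrite intf0; apply/negP; rewrite -ltNge.
by rewrite mulr_gt0 ?subr_gt0// divr_gt0.
Qed.

Lemma Rintegral_FTC2 (R : realType) (f F : R -> R) (a b : R) : a < b ->
  continuous f -> continuous F ->
  (forall s, s \in `]a, b[ -> is_derive s 1 F (f s)) ->
  \int[@lebesgue_measure R]_(s in `[a, b]) f s = F b - F a.
Proof.
move=> ab cf cF dF; rewrite /Rintegral (continuous_FTC2 ab (F := F))//.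
- exact: continuous_subspaceT.
- split; first by move=> s /dF [].
  + by apply: cvg_at_right_filter; exact: cF.
  + by apply: cvg_at_left_filter; exact: cF.
- by move=> s /dF dFs; rewrite derive1E derive_val.
Qed.

(* The decomposition of 'rV_d.+1 used by torus_integral. *)
Definition vcons (R : realType) (d : nat) (x : R) (y : 'rV[R]_d) : 'rV[R]_d.+1 :=
  row_mx (x%:M : 'M[R]_1) y.

Lemma continuous_vcons (R : realType) (d : nat) (P : topologicalType)
    (f : P -> R) (g : P -> 'rV[R]_d) :
  continuous f -> continuous g -> continuous (fun p => vcons (f p) (g p)).
Proof.
move=> cf cg p; apply: cvg_mx => i j.
rewrite /vcons; under eq_fun do rewrite mxE; rewrite mxE.
case: splitP => k _.
  under eq_fun do rewrite mxE; rewrite mxE ord1 (ord1 k) eqxx; exact: cf.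
rewrite ord1; exact: (continuous_comp (cg p) (@coord_continuous R 1 d 0 k _)).
Qed.

Lemma torus_integral_continuous (R : realType) (ell : R) (d : nat)
    (P : topologicalType) (f : P -> 'rV[R]_d -> R) : 0 <= ell ->
  continuous (fun p : P * 'rV[R]_d => f p.1 p.2) ->
  continuous (fun p => torus_integral ell (f p)).
Proof.
move=> l0; elim: d P f => [|d IHd] P f cf /=.
  apply: (continuous_compose (f := fun p => (p, 0 : 'rV[R]_0)) _ cf).
  apply: continuous_pair; [by move=> x; exact: cvg_id|exact: continuous_cst].
apply: (@continuous_Rintegral R P (fun ps : P * R => torus_integral ell
  (fun y : 'rV[R]_d => f ps.1 (vcons ps.2 y)))) => //.
apply: (IHd _ (fun (ps : P * R) y => f ps.1 (vcons ps.2 y))).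
apply: (continuous_compose (f := fun q : P * R * 'rV[R]_d =>
  (q.1.1, vcons q.1.2 q.2)) _ cf).
apply: continuous_pair.
  exact: (continuous_compose (@continuous_fst _ _) (@continuous_fst _ _)).
apply: continuous_vcons; last exact: continuous_snd.
exact: (continuous_compose (@continuous_fst _ _) (@continuous_snd _ _)).
Qed.

Lemma continuous_vcons_l (R : realType) (d : nat) (x : R) :
  continuous (@vcons R d x).
Proof. by apply: continuous_vcons; [exact: continuous_cst|move=> y; exact: cvg_id]. Qed.

Lemma continuous_vcons_pair (R : realType) (d : nat) :
  continuous (fun p : R * 'rV[R]_d => vcons p.1 p.2).
Proof. by apply: continuous_vcons; [exact: continuous_fst|exact: continuous_snd]. Qed.

Lemma torus_integral_vcons_continuous (R : realType) (ell : R) (d : nat)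
    (f : 'rV[R]_d.+1 -> R) : 0 <= ell -> continuous f ->
  continuous (fun x => torus_integral ell (fun y => f (vcons x y))).
Proof.
move=> l0 cf; apply: torus_integral_continuous => //.
exact: (continuous_compose (@continuous_vcons_pair R d) cf).
Qed.

Lemma torus_integral_lin (R : realType) (ell : R) (d : nat) (a : R)
    (f g : 'rV[R]_d -> R) : 0 <= ell -> continuous f -> continuous g ->
  torus_integral ell (fun x => a * f x + g x)
    = a * torus_integral ell f + torus_integral ell g.
Proof.
move=> l0; elim: d f g => [//|d IHd] f g cf cg /=.
under eq_Rintegral => x _.
  rewrite (IHd (fun y => f (vcons x y)) (fun y => g (vcons x y))); last 2 first.
  - exact: (continuous_compose (@continuous_vcons_l R d x) cf).
  - exact: (continuous_compose (@continuous_vcons_l R d x) cg).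
  over.
have ci h : continuous h -> lebesgue_measure.-integrable `[0, ell]
    (EFin \o (fun x => torus_integral ell (fun y : 'rV[R]_d => h (vcons x y)))).
  by move=> ch; apply: continuous_integrable_itv; exact: torus_integral_vcons_continuous.
rewrite RintegralD// ?RintegralZl//; [exact: ci| |exact: ci].
apply: (@continuous_integrable_itv R
  (fun x => a * torus_integral ell (fun y : 'rV[R]_d => f (vcons x y)))) => x.
by apply: cvgMr; exact: torus_integral_vcons_continuous.
Qed.

Lemma torus_integral_ge0 (R : realType) (ell : R) (d : nat) (f : 'rV[R]_d -> R) :
  (forall x, 0 <= f x) -> 0 <= torus_integral ell f.
Proof.
elim: d f => [|d IHd] f f0; first exact: f0.
by apply: fine_ge0; apply: integral_ge0 => x _; rewrite lee_fin; exact: IHd.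
Qed.

(** The slice integrals are nonnegative and continuous in the first coordinate, so a zero outer
    integral annihilates each of them, and the induction applies to every slice. The integral sees
    the cell only, hence the restriction on [x]. *)
Lemma torus_integral_eq0 (R : realType) (ell : R) (d : nat) (f : 'rV[R]_d -> R) :
  0 < ell -> continuous f -> (forall x, 0 <= f x) ->
  torus_integral ell f = 0 -> forall x, cell ell x -> f x = 0.
Proof.
move=> l0; elim: d f => [|d IHd] f cf f0.
  by move=> /= f00 x _; rewrite (_ : x = 0)//; apply/rowP => -[].
move=> fi x cx.
have -> : x = vcons (x 0 0) (rsubmx (x : 'rV_(1 + d))).
  rewrite -[LHS](@hsubmxK _ 1 1 d) /vcons; f_equal.
  by apply/rowP => i; rewrite !mxE ord1; congr (x _ _); apply/val_inj.
apply: (IHd (fun y => f (vcons (x 0 0) y))) => //.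
- exact: (continuous_compose (@continuous_vcons_l R d _) cf).
- apply: (Rintegral_itv_eq0 l0 _ _ fi); last exact: cx.
    by apply: torus_integral_vcons_continuous => //; exact: ltW.
  by move=> s _; exact: torus_integral_ge0.
- by move=> i; rewrite mxE; exact: cx.
Qed.

Lemma vconsD (R : realType) (d : nat) (x x' : R) (y y' : 'rV[R]_d) :
  vcons x y + vcons x' y' = vcons (x + x') (y + y').
Proof. by apply/rowP => j; rewrite !mxE; case: splitP => k _; rewrite !mxE ?mulrnDl. Qed.

Lemma vconsZ (R : realType) (d : nat) (a x : R) (y : 'rV[R]_d) :
  a *: vcons x y = vcons (a * x) (a *: y).
Proof. by apply/rowP => j; rewrite !mxE; case: splitP => k _; rewrite !mxE ?mulrnAr. Qed.

Lemma delta_vcons0 (R : realType) (d : nat) :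
  delta_mx 0 ord0 = vcons 1 0 :> 'rV[R]_d.+1.
Proof.
apply/rowP => j; rewrite !mxE eqxx/=; case: splitP => k jk; rewrite !mxE.
  by rewrite !ord1 -val_eqE/= jk ord1.
by rewrite -val_eqE/= jk.
Qed.

Lemma delta_vcons_lift (R : realType) (d : nat) (i : 'I_d) :
  delta_mx 0 (lift ord0 i) = vcons 0 (delta_mx 0 i) :> 'rV[R]_d.+1.
Proof.
apply/rowP => j; rewrite !mxE eqxx/=; case: splitP => k jk; rewrite !mxE.
  by rewrite !ord1 -val_eqE/= jk ord1 mul0rn.
by rewrite eqxx -!val_eqE/= jk.
Qed.

(** The derivative is dominated by a constant, the maximum of [|g|] on a compact rectangle around
    [s]. Continuity is asked everywhere but differentiability only on []u, v[], which is the
    situation of fields with clamped time. *)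
Lemma Rintegral_derive (R : realType) (f g : R -> R -> R) (a b u v : R) :
  a <= b -> continuous (fun p : R * R => f p.1 p.2) ->
  continuous (fun p : R * R => g p.1 p.2) ->
  (forall s x, s \in `]u, v[ -> is_derive s 1 (f ^~ x) (g s x)) ->
  forall s, s \in `]u, v[ ->
    is_derive s 1 (fun s => \int[@lebesgue_measure R]_(x in `[a, b]) f s x)
      (\int[@lebesgue_measure R]_(x in `[a, b]) g s x).
Proof.
move=> ab cf cg dfg s suv.
have cs (h : R -> R -> R) (r : R) : continuous (fun p : R * R => h p.1 p.2) ->
    continuous (h r).
  move=> ch; apply: (continuous_compose (f := fun x => (r, x)) _ ch).
  by apply: continuous_pair; [exact: continuous_cst|move=> x; exact: cvg_id].
have /andP[us sv] : u < s < v by move: suv; rewrite in_itv.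
pose u' := (u + s) / 2; pose v' := (s + v) / 2.
have u'v' : [/\ u < u', u' < s, s < v' & v' < v] by rewrite /u' /v'; split; lra.
case: u'v' => uu' u's sv' v'v.
have sub r : r \in `]u', v'[ -> r \in `]u, v[.
  rewrite !in_itv/= => /andP[ur rv].
  by rewrite (lt_trans uu' ur) (lt_trans rv v'v).
have [|||c _ cmax] := @compact_EVT_max (R * R)%type R (fun p => `|g p.1 p.2|)
    (`[u', v']%classic `*` `[a, b]%classic).
- by exists (s, a); split; rewrite /= in_itv/= ?ab ?lexx// (ltW u's) (ltW sv').
- by apply: compact_setX; exact: segment_compact.
- by apply: continuous_subspaceT => p; apply: cvg_norm; exact: cg.
pose M := `|g c.1 c.2|.
have d1 r x : r \in `]u', v'[ -> partial1of2 f r x = g r x.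
  by move=> /sub/(dfg _ x) df; rewrite partial1of2E derive_val.
have su'v' : `]u', v'[%classic s by rewrite /= in_itv/= u's sv'.
have H1 r : `]u', v'[%classic r ->
    lebesgue_measure.-integrable `[a, b] (EFin \o f r).
  by move=> _; apply: continuous_integrable_itv; exact: cs.
have H2 r x : `]u', v'[%classic r -> `[a, b]%classic x -> derivable (f ^~ x) r 1.
  by move=> /sub/(dfg _ x) [].
have H3 : forall x : R, 0 <= cst M x by move=> x; exact: normr_ge0.
have H4 : lebesgue_measure.-integrable `[a, b] (EFin \o cst M).
  by apply: continuous_integrable_itv; exact: continuous_cst.
have H5 r x : `]u', v'[%classic r -> `[a, b]%classic x ->
    `|partial1of2 f r x| <= cst M x.
  move=> ru xab; rewrite d1//; apply: (cmax (r, x)); rewrite inE; split => //=.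
  exact: subset_itv_oo_cc ru.
apply: DeriveDef.
  exact: (@derivable_under_integral R _ _ (@lebesgue_measure R) f _
    (measurable_itv _) s u' v' su'v' H1 H2 _ H3 H4 H5).
rewrite -derive1E.
rewrite (@differentiation_under_integral R _ _ (@lebesgue_measure R) f _
  (measurable_itv _) s u' v' su'v' H1 H2 _ H3 H4 H5).
by apply: eq_Rintegral => x _; rewrite d1.
Qed.

Lemma torus_integral_derive (R : realType) (ell : R) (d : nat)
    (f g : R -> 'rV[R]_d -> R) (u v : R) : 0 <= ell ->
  continuous (fun p : R * 'rV[R]_d => f p.1 p.2) ->
  continuous (fun p : R * 'rV[R]_d => g p.1 p.2) ->
  (forall s x, s \in `]u, v[ -> is_derive s 1 (f ^~ x) (g s x)) ->
  forall s, s \in `]u, v[ ->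
    is_derive s 1 (fun s => torus_integral ell (f s)) (torus_integral ell (g s)).
Proof.
move=> l0; elim: d f g => [|d IHd] f g cf cg dfg; first by move=> s; exact: dfg.
have cr (h : R -> 'rV[R]_d.+1 -> R) :
    continuous (fun p : R * 'rV[R]_d.+1 => h p.1 p.2) ->
    continuous (fun p : R * R * 'rV[R]_d => h p.1.1 (vcons p.1.2 p.2)).
  move=> ch; apply: (continuous_compose (f := fun q : R * R * 'rV[R]_d =>
    (q.1.1, vcons q.1.2 q.2)) _ ch).
  apply: continuous_pair.
    exact: (continuous_compose (@continuous_fst _ _) (@continuous_fst _ _)).
  apply: continuous_vcons; last exact: continuous_snd.
  exact: (continuous_compose (@continuous_fst _ _) (@continuous_snd _ _)).
apply: (@Rintegral_derive R
  (fun s x => torus_integral ell (fun y : 'rV[R]_d => f s (vcons x y)))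
  (fun s x => torus_integral ell (fun y : 'rV[R]_d => g s (vcons x y)))) => //.
- exact: (@torus_integral_continuous R ell d (R * R)%type
    (fun p y => f p.1 (vcons p.2 y)) l0 (cr _ cf)).
- exact: (@torus_integral_continuous R ell d (R * R)%type
    (fun p y => g p.1 (vcons p.2 y)) l0 (cr _ cg)).
move=> s x suv.
apply: (IHd (fun s y => f s (vcons x y)) (fun s y => g s (vcons x y))) => //.
- apply: (continuous_compose (f := fun q : R * 'rV[R]_d => ((q.1, x), q.2)) _ (cr _ cf)).
  apply: continuous_pair; last exact: continuous_snd.
  by apply: continuous_pair; [exact: continuous_fst|exact: continuous_cst].
- apply: (continuous_compose (f := fun q : R * 'rV[R]_d => ((q.1, x), q.2)) _ (cr _ cg)).
  apply: continuous_pair; last exact: continuous_snd.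
  by apply: continuous_pair; [exact: continuous_fst|exact: continuous_cst].
Qed.

(** In the first coordinate, the fundamental theorem applied to the inner integral leaves the
    difference of its values at [ell] and at 0, which agree by periodicity. In a later coordinate,
    each slice integral vanishes by induction. Applied to products, this is integration by parts
    without boundary term. *)
Lemma torus_integral_pder (R : realType) (ell : R) (d : nat)
    (f : 'rV[R]_d -> R) (i : 'I_d) : 0 < ell ->
  continuous f -> (forall x, derivable f x (delta_mx 0 i)) ->
  continuous (pder i f) -> on_torus ell f -> torus_integral ell (pder i f) = 0.
Proof.
move=> l0; elim: d f i => [|d IHd] f i cf df cdf ft; first by case: i df cdf.
case: (unliftP ord0 i) => [j|] ij; subst i.
  have E x y : pder (lift ord0 j) f (vcons x y) = pder j (fun y => f (vcons x y)) y.
    rewrite /pder /derive; do 2 f_equal; apply/funext => h /=.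
    by rewrite delta_vcons_lift vconsZ mulr0 vconsD add0r.
  have Z x : torus_integral ell (fun y => pder (lift ord0 j) f (vcons x y)) = 0.
    under [X in torus_integral _ X]eq_fun do rewrite E.
    apply: IHd.
    - exact: (continuous_compose (@continuous_vcons_l R d x) cf).
    - move=> y; have := df (vcons x y); rewrite /derivable.
      rewrite (_ : (fun h => _) = (fun h : R => h^-1 *:
        (f (vcons x (h *: delta_mx 0 j + y)) - f (vcons x y)))) => [//|].
      by apply/funext => h /=; rewrite delta_vcons_lift vconsZ mulr0 vconsD add0r.
    - rewrite (_ : pder j _ = fun y => pder (lift ord0 j) f (vcons x y)).
        exact: (continuous_compose (@continuous_vcons_l R d x) cdf).
      by apply/funext => y; rewrite E.
    - move=> k y; rewrite -[RHS](ft (lift ord0 k)).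
      by rewrite delta_vcons_lift vconsZ mulr0 vconsD addr0.
  rewrite [LHS](@eq_Rintegral _ _ _ _ _ (cst 0)); last by move=> x _; exact: Z.
  by rewrite Rintegral_cst_itv ?mul0r// ltW.
have ck (h : 'rV[R]_d.+1 -> R) : continuous h ->
    continuous (fun p : R * 'rV[R]_d => h (vcons p.1 p.2)).
  by move=> ch; exact: (continuous_compose (@continuous_vcons_pair R d) ch).
have dF s y : is_derive s (1 : R) (fun k => f (vcons k y)) (pder ord0 f (vcons s y)).
  have E k : k *: delta_mx 0 ord0 + vcons 0 y = vcons k y.
    by rewrite delta_vcons0 vconsZ mulr1 scaler0 vconsD addr0 add0r.
  have := @is_derive_line R d.+1 f (vcons 0 y) (delta_mx 0 ord0) s (df _).
  by rewrite E; under eq_fun do rewrite E.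
rewrite [LHS](@Rintegral_FTC2 R _
  (fun s => torus_integral ell (fun y : 'rV[R]_d => f (vcons s y))) 0 ell)//.
- apply/eqP; rewrite subr_eq0; apply/eqP; f_equal; apply/funext => y.
  rewrite -[RHS](ft ord0) delta_vcons0 vconsZ mulr1 scaler0 vconsD.
  by rewrite add0r addr0.
- by apply: torus_integral_vcons_continuous => //; exact: ltW.
- by apply: torus_integral_vcons_continuous => //; exact: ltW.
- apply: (@torus_integral_derive R ell d (fun s y => f (vcons s y))
    (fun s y => pder ord0 f (vcons s y)) 0 ell); first exact: ltW.
  + exact: ck.
  + exact: ck.
Qed.

(** * The minimum principle *)

Lemma is_derive_cvg (R : realType) (f : R -> R) (x l : R) : is_derive x 1 f l ->
  h^-1 * (f (h + x) - f x) @[h --> 0^'] --> l.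
Proof.
move=> [df <-]; move: df; rewrite /derivable /derive.
under eq_fun do rewrite /= [X in X *: _]/(GRing.inv _) /GRing.scale/= mulr1.
exact.
Qed.

Lemma cvg_is_derive (R : realType) (f : R -> R) (x l : R) :
  h^-1 * (f (h + x) - f x) @[h --> 0^'] --> l -> is_derive x 1 f l.
Proof.
move=> fl.
have E : (fun h : R => h^-1 *: ((f \o shift x) (h *: (1 : R)) - f x))
    = (fun h => h^-1 * (f (h + x) - f x)).
  by apply/funext => h; rewrite /= /GRing.scale/= mulr1.
apply: DeriveDef; first by rewrite /derivable E; apply/cvg_ex; exists l.
by rewrite /derive E; apply: cvg_lim fl.
Qed.

(** Meant for two filters: the punctured neighbourhoods of 0, at times inside []t, T[], and the left
    neighbourhoods of 0, at any time after [t], including [T]. *)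
Lemma time_quotient_within (R : realType) (t T : R) (f : R -> R) (s l : R)
    (F : set_system R) (FF : Filter F) : F `=>` 0^' ->
  (\forall h \near F, s + h \in `[t, T]) ->
  time_quotient t T f s --> l -> h^-1 * (f (s + h) - f s) @[h --> F] --> l.
Proof.
move=> F0 Fin fl U /fl; rewrite /time_quotient /fmap/= /within/= => /F0 FU.
by apply: (filterS2 _ _ Fin FU) => h /= hin; exact.
Qed.

Lemma time_quotient_derive (R : realType) (t T : R) (f : R -> R) (s l : R) :
  s \in `]t, T[ -> time_quotient t T f s --> l -> is_derive s 1 f l.
Proof.
rewrite in_itv/= => /andP[ts sT] fl; apply: cvg_is_derive.
under eq_fun do rewrite [_ + s]addrC.
apply: (time_quotient_within _ _ _ fl) => //.
have d0 : 0 < Num.min (s - t) (T - s) by rewrite lt_min !subr_gt0 ts sT.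
apply/nbhs_ballP; exists (Num.min (s - t) (T - s)) => //= h.
rewrite /ball/= sub0r normrN lt_min => /andP[h1 h2] _.
rewrite in_itv/=; move: h1 h2; rewrite !ltr_norml => /andP[h1 _] /andP[_ h2].
by apply/andP; split; lra.
Qed.

(** If [l < 0], then [g'], which vanishes at 0, is negative just to the right of 0, and the mean
    value theorem puts [g] below [g 0] there. *)
Lemma second_derivative_min (R : realType) (g g' : R -> R) (l : R) :
  (forall k : R, is_derive k 1 g (g' k)) -> is_derive (0 : R) 1 g' l -> g' 0 = 0 ->
  (forall k, g 0 <= g k) -> 0 <= l.
Proof.
move=> dg dg' g'0 gmin; rewrite leNgt; apply/negP => l0.
have /cvgr_lt/(_ _ l0) : h^-1 * (g' (h + 0) - g' 0) @[h --> 0^'] --> l.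
  exact: is_derive_cvg.
move=> /nbhs_ballP[e /= e0 He].
have e20 : 0 < e / 2 by rewrite divr_gt0.
have [|c] := @MVT R g g' 0 (e / 2) e20 (fun k _ => dg k).
- by apply: derivable_within_continuous => k _; have [] := dg k.
rewrite in_itv/= => /andP[c0 ce] E.
have : c^-1 * (g' (c + 0) - g' 0) < 0.
  apply: He; last by rewrite gt_eqF.
  rewrite /ball/= sub0r normrN gtr0_norm// (lt_trans ce)//.
  by rewrite ltr_pdivrMr// ltr_pMr// ltr1n.
rewrite g'0 subr0 addr0 pmulr_rlt0 ?invr_gt0// => g'c.
have := gmin (e / 2); rewrite -subr_ge0 E subr0 pmulr_lge0//.
by rewrite leNgt g'c.
Qed.

Lemma laplacian_min (R : realType) (d : nat) (f : 'rV[R]_d -> R) (x : 'rV[R]_d) :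
  (forall y i, derivable f y (delta_mx 0 i)) ->
  (forall y i, derivable (pder i f) y (delta_mx 0 i)) ->
  (forall y, f x <= f y) ->
  (forall i, pder i f x = 0) /\ 0 <= laplacian f x.
Proof.
move=> df ddf fmin.
have line i (k : R) : is_derive k 1 (fun k : R => f (k *: delta_mx 0 i + x))
    (pder i f (k *: delta_mx 0 i + x)).
  exact: is_derive_line.
have grad0 i : pder i f x = 0.
  have [] := @derive1_at_min R (fun k : R => f (k *: delta_mx 0 i + x)) (-1) 1 0.
  - lra.
  - by move=> k _; have [] := line i k.
  - by rewrite in_itv/= ltrN10 ltr01.
  - by move=> k _; rewrite scale0r add0r.
  by move=> _; rewrite (derive_val (is_derive := line i 0)) scale0r add0r.
split=> //; apply: sumr_ge0 => i _.
apply: (second_derivative_min (line i)).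
- have := @is_derive_line R d (pder i f) x (delta_mx 0 i) 0 (ddf _ _).
  by rewrite scale0r add0r.
- by rewrite scale0r add0r.
- by move=> k; rewrite scale0r add0r.
Qed.

(** The drift [b] is arbitrary because the gradient vanishes at a minimum. Regularity is listed item
    by item, with [rt] given as a limit, so that a difference of two densities can be inserted
    without establishing [C12] for it. *)
Lemma minimum_principle (R : realType) (d : nat) (ell D t T K : R)
    (r rt c : R -> 'rV[R]_d -> R) (b : R -> 'rV[R]_d -> 'I_d -> R) :
  0 < ell -> 0 <= D -> t < T ->
  (forall s, s \in `[t, T] -> on_torus ell (r s)) ->
  jointly_continuous t T r ->
  (forall s x, s \in `[t, T] -> time_quotient t T (r ^~ x) s --> rt s x) ->
  (forall s x i, s \in `[t, T] -> derivable (r s) x (delta_mx 0 i)) ->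
  (forall s x i, s \in `[t, T] -> derivable (pder i (r s)) x (delta_mx 0 i)) ->
  (forall s x, s \in `[t, T] -> cell ell x -> - K <= c s x) ->
  (forall s x, s \in `[t, T] ->
    rt s x + \sum_(i < d) b s x i * pder i (r s) x + c s x * r s x
    = D * laplacian (r s) x) ->
  (forall x, 0 <= r t x) -> forall s x, s \in `[t, T] -> 0 <= r s x.
Proof.
move=> l0 D0 tT rper rcont rtime dr ddr cK eqn r0 s1 x1 s1tT.
rewrite leNgt; apply/negP => r1.
(* At a negative minimum of exp (- k s) r_s, which cannot be at time t, one has
   rt <= k r, whereas the equation gives rt >= - c r > k r. *)
pose k := K + 1.
pose w (p : R * 'rV[R]_d) := expR (- k * p.1) * r (clamp t T p.1) p.2.
have cw : continuous w.
  move=> p; apply: cvgM; last exact: (continuous_clamp (ltW tT) rcont).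
  apply: (continuous_compose (f := fun p : R * 'rV[R]_d => - k * p.1) _
    (@continuous_expR R)).
  by move=> q; apply: cvgMr; exact: continuous_fst.
have [|||[s0 x0]] := @compact_EVT_min _ R w (`[t, T]%classic `*` @cell R ell d).
- exists (t, 0); split; first by rewrite /= in_itv/= lexx ltW.
  exact/cell0/ltW.
- by apply: compact_setX; [exact: segment_compact|exact: cell_compact].
- exact: continuous_subspaceT.
rewrite inE => -[/= s0tT x0c] wmin.
(* The minimum over the cell is a minimum over all of R^d, so that [s0] and [x0] can be compared
   with unrestricted points, as the tests on first and second derivatives require. *)
have wge s x : s \in `[t, T] ->
    expR (- k * s0) * r s0 x0 <= expR (- k * s) * r s x.
  move=> stT; have [y yc xy] := cell_repr x l0.
  rewrite (xy _ _ (rper s stT)).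
  have := wmin (s, y); rewrite /w/= !clamp_id//; apply.
  by rewrite inE.
have rs0 : r s0 x0 < 0.
  rewrite -(pmulr_rlt0 _ (expR_gt0 (- k * s0))).
  by apply: le_lt_trans (wge s1 x1 s1tT) _; rewrite pmulr_rlt0 ?expR_gt0.
have ts0 : t < s0.
  move: s0tT; rewrite in_itv/= le_eqVlt => /andP[/predU1P[ts0|//] _].
  by move: rs0; rewrite -ts0 ltNge r0.
have rmin y : r s0 x0 <= r s0 y by rewrite -(ler_pM2l (expR_gt0 (- k * s0))) wge.
have [grad0 lap0] := @laplacian_min R d (r s0) x0 (fun y i => dr s0 y i s0tT)
  (fun y i => ddr s0 y i s0tT) rmin.
(* Only increments [h < 0] are used, since they remain available when [s0 = T]. Minimality gives
   r_(s0+h) >= exp(k h) r_s0 at [x0]; subtracting r_s0 and dividing by [h] reverses the inequality,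
   and the quotient of the exponential tends to [k]. *)
have rt_le : rt s0 x0 <= r s0 x0 * k.
  have e1 : h^-1 * (expR (k * (h + 0)) - expR (k * 0)) @[h --> 0^'] --> k.
    apply: (@is_derive_cvg R (fun h => expR (k * h)) 0 k).
    have dk : is_derive (0 : R) 1 ( *%R k) k.
      have := is_deriveZ k (is_derive_id (0 : R) 1).
      by rewrite /GRing.scale/= mulr1.
    have := is_derive1_comp (is_derive_expR (k * 0)) dk.
    by rewrite mulr0 expR0 mul1r.
  have e2 := cvg_dnbhs_at_left e1.
  apply: (@ler_cvg_to _ (0^'-) _ R
    (fun h => h^-1 * (r (s0 + h) x0 - r s0 x0))
    (fun h => r s0 x0 * (h^-1 * (expR (k * (h + 0)) - expR (k * 0))))).
  - apply: (@time_quotient_within R t T (r ^~ x0) s0 _ _ _ _ _ (rtime s0 x0 s0tT)).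
      move=> U; rewrite /at_left /dnbhs /within/=.
      apply: (@filterS _ (nbhs (0 : R))) => h + h0.
      by apply; rewrite lt_eqF.
    near=> h; rewrite in_itv/=; apply/andP; split.
      rewrite -lerBlDl; near: h; apply: nbhs_left_ge.
      by rewrite subr_lt0.
    apply: (@le_trans _ _ s0); last by move: s0tT; rewrite in_itv => /andP[].
    by rewrite gerDl; near: h; exact: nbhs_left_le.
  - by apply: cvgMr; exact: e2.
  near=> h.
  have h0 : h < 0 by near: h; exact: nbhs_left_lt.
  have stT : s0 + h \in `[t, T].
    rewrite in_itv/=; apply/andP; split.
      rewrite -lerBlDl; near: h; apply: nbhs_left_ge.
      by rewrite subr_lt0.
    apply: (@le_trans _ _ s0); last by move: s0tT; rewrite in_itv => /andP[].
    by rewrite gerDl ltW.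
  have := wge (s0 + h) x0 stT.
  rewrite mulrDr expRD -mulrA ler_pM2l ?expR_gt0// => H.
  rewrite mulrCA ler_nM2l ?invr_lt0// addr0 mulr0 expR0 mulrBr mulr1.
  rewrite lerD2r -(@ler_pM2l _ (expR (- k * h))) ?expR_gt0//.
  by rewrite mulrCA -expRD mulNr addNr expR0 mulr1 -mulNr.
have := eqn s0 x0 s0tT; rewrite big1 => [|i _]; last by rewrite grad0 mulr0.
rewrite addr0 => E.
have : 0 <= D * laplacian (r s0) x0 by rewrite mulr_ge0.
rewrite -E => H; have := cK s0 x0 s0tT x0c.
(* As [B < 0] and [C >= - K], one gets A + C B <= (K + 1) B - K B = B < 0, against A + C B >= 0. The
   strict sign is what the [+ 1] in [k] provides. *)
move: H rt_le rs0; rewrite /k; move: (rt s0 x0) (r s0 x0) (c s0 x0) => A B C.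
clear; nra.
Unshelve. all: by end_near. Qed.

(** * The cost of an admissible pair *)

Lemma continuous_addf (R : realType) (P : topologicalType) (f g : P -> R) :
  continuous f -> continuous g -> continuous (fun p => f p + g p).
Proof. by move=> cf cg p; apply: cvgD; [exact: cf|exact: cg]. Qed.

Lemma continuous_oppf (R : realType) (P : topologicalType) (f : P -> R) :
  continuous f -> continuous (fun p => - f p).
Proof. by move=> cf p; apply: cvgN; exact: cf. Qed.

Lemma continuous_mulf (R : realType) (P : topologicalType) (f g : P -> R) :
  continuous f -> continuous g -> continuous (fun p => f p * g p).
Proof. by move=> cf cg p; apply: cvgM; [exact: cf|exact: cg]. Qed.

Lemma continuous_sumf (R : realType) (P : topologicalType) (I : Type)
    (s : seq I) (f : I -> P -> R) :
  (forall i, continuous (f i)) -> continuous (fun p => \sum_(i <- s) f i p).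
Proof.
move=> cf; elim: s => [|i s IHs].
  by under eq_fun do rewrite big_nil; exact: continuous_cst.
under eq_fun do rewrite big_cons; exact: continuous_addf.
Qed.

Lemma continuous_coord (R : realType) (P : topologicalType) (d : nat)
    (v : P -> 'rV[R]_d) i :
  continuous v -> continuous (fun p => v p 0 i).
Proof. by move=> cv; exact: (continuous_compose cv (@coord_continuous R 1 d 0 i)). Qed.

Lemma continuous_dotp (R : realType) (P : topologicalType) (d : nat)
    (v w : P -> 'rV[R]_d) :
  (forall i, continuous (fun p => v p 0 i)) ->
  (forall i, continuous (fun p => w p 0 i)) ->
  continuous (fun p => dotp (v p) (w p)).
Proof. by move=> cv cw; apply: continuous_sumf => i; exact: continuous_mulf. Qed.

Lemma torus_integral0 (R : realType) (ell : R) (d : nat) : 0 <= ell ->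
  torus_integral ell (fun _ : 'rV[R]_d => 0) = 0.
Proof.
(* With coefficient -1, linearity reads I = - I + I for the integral I of 0. *)
move=> l0; have := @torus_integral_lin R ell d (-1) (cst 0) (cst 0) l0
  (@continuous_cst _ _ _) (@continuous_cst _ _ _).
by under [X in torus_integral _ X = _]eq_fun do rewrite /cst mulr0 addr0; lra.
Qed.

Lemma torus_integral_sum0 (R : realType) (ell : R) (d : nat) (I : Type)
    (s : seq I) (f : I -> 'rV[R]_d -> R) : 0 < ell ->
  (forall i, continuous (f i)) -> (forall i, torus_integral ell (f i) = 0) ->
  torus_integral ell (fun x => \sum_(i <- s) f i x) = 0.
Proof.
move=> l0 cf f0; elim: s => [|i s IHs].
  under [X in torus_integral _ X]eq_fun do rewrite big_nil.
  exact/torus_integral0/ltW.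
under [X in torus_integral _ X]eq_fun do rewrite big_cons -[X in X + _]mul1r.
rewrite torus_integral_lin ?f0 ?IHs ?mulr0 ?addr0//; first exact: ltW.
exact: continuous_sumf.
Qed.

Lemma is_derive_mulf (R : realType) (V : normedModType R) (f g : V -> R)
    (x v : V) (df dg : R) : is_derive x v f df -> is_derive x v g dg ->
  is_derive x v (fun y => f y * g y) (f x * dg + g x * df).
Proof. by move=> hf hg; exact: is_deriveM. Qed.

Lemma is_derive_addf (R : realType) (V : normedModType R) (f g : V -> R)
    (x v : V) (df dg : R) : is_derive x v f df -> is_derive x v g dg ->
  is_derive x v (fun y => f y + g y) (df + dg).
Proof. by move=> hf hg; exact: is_deriveD. Qed.

Lemma is_derive_oppf (R : realType) (V : normedModType R) (f : V -> R)
    (x v : V) (df : R) : is_derive x v f df ->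
  is_derive x v (fun y => - f y) (- df).
Proof. by move=> hf; exact: is_deriveN. Qed.

(** What [C12] leaves at a frozen time, reduced to the pure second derivatives, the only ones in a
    Laplacian. *)
Record C2_torus (R : realType) (d : nat) (ell : R) (f : 'rV[R]_d -> R) : Prop := {
  C2_per : on_torus ell f;
  C2_cont : continuous f;
  C2_der : forall i x, derivable f x (delta_mx 0 i);
  C2_der_cont : forall i, continuous (pder i f);
  C2_der2 : forall i x, derivable (pder i f) x (delta_mx 0 i);
  C2_der2_cont : forall i, continuous (pder i (pder i f))
}.

(* At a point x, with p = phi x and r = rho x, the families are the coordinates of
   alpha (a), grad phi (g) and u, together with d_ii phi (pp), d_ii rho (rr),
   d_i rho (rd) and d_i (rho (u_i + alpha_i)) (w). The last sum is the divergence of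
   D phi grad rho - D rho grad phi - phi rho (u + alpha). *)
Lemma energy_density_identity (R : comUnitRingType) (d : nat) (D f p r : R)
    (h2 : 2 * 2^-1 = 1 :> R) (a g u pp rr rd w : 'I_d -> R) :
  (f - 2^-1 * (\sum_(i < d) g i * g i) - \sum_(i < d) g i * u i
     - D * \sum_(i < d) pp i) * r + p * (D * \sum_(i < d) rr i - \sum_(i < d) w i)
  = (2^-1 * \sum_(i < d) a i * a i + f) * r
    - 2^-1 * (\sum_(i < d) (a i - g i) * (a i - g i)) * r
    + \sum_(i < d) (D * (p * rr i + rd i * g i) - D * (r * pp i + g i * rd i)
        - (p * w i + r * (u i + a i) * g i)).
Proof.
have -> : \sum_(i < d) (a i - g i) * (a i - g i) = \sum_(i < d) a i * a i
    + \sum_(i < d) g i * g i - 2 * \sum_(i < d) g i * a i.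
  by rewrite mulr_sumr -big_split -sumrB; apply: eq_bigr => i _ /=; ring.
have -> : \sum_(i < d) (D * (p * rr i + rd i * g i) - D * (r * pp i + g i * rd i)
        - (p * w i + r * (u i + a i) * g i))
    = D * p * (\sum_(i < d) rr i) - D * r * (\sum_(i < d) pp i)
      - p * (\sum_(i < d) w i) - r * (\sum_(i < d) g i * u i)
      - r * (\sum_(i < d) g i * a i).
  by rewrite !mulr_sumr -!sumrB; apply: eq_bigr => i _ /=; ring.
have K A B S : 2^-1 * (A + B - 2 * S) = 2^-1 * A + 2^-1 * B - S :> R.
  transitivity (2^-1 * A + 2^-1 * B - (2 * 2^-1) * S); first by ring.
  by rewrite h2 mul1r.
rewrite K; ring.
Qed.

(** At a frozen time, the derivative of phi rho is the running cost density minus the weighted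
    squared deviation plus the divergence of a periodic flux, which integrates to 0. The terms in
    [u] cancel because its advective form in the equation for phi is adjoint to its conservative
    form in the equation for rho. Transport by [a] leaves rho grad phi . a, the cross term that
    completes the square. *)
Lemma torus_energy (R : realType) (d : nat) (ell D : R)
    (f0 pt rt phi rho : 'rV[R]_d -> R) (u a : 'rV[R]_d -> 'rV[R]_d) : 0 < ell ->
  C2_torus ell phi -> C2_torus ell rho -> on_torus ell u -> on_torus ell a ->
  C1_field u -> C1_field a -> continuous f0 ->
  (forall x, pt x + 2^-1 * dotp (grad phi x) (grad phi x) + dotp (grad phi x) (u x)
     + D * laplacian phi x = f0 x) ->
  (forall x, rt x + divergence (fun y => rho y *: (u y + a y)) x
     = D * laplacian rho x) ->
  torus_integral ell (fun x => pt x * rho x + phi x * rt x)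
  = torus_integral ell (fun x => (lagrangian (a x) + f0 x) * rho x)
    - torus_integral ell (fun x =>
        2^-1 * dotp (a x - grad phi x) (a x - grad phi x) * rho x).
Proof.
move=> l0 [phiper phic phid phidc phid2 phid2c] [rhoper rhoc rhod rhodc rhod2 rhod2c].
move=> uper aper [uc u1] [ac a1] fc hjb tr.
pose v i x := rho x * (u x 0 i + a x 0 i).
pose W i x := D * (phi x * pder i rho x) + - (D * (rho x * pder i phi x))
  + - (phi x * v i x).
pose dv i x := rho x * (pder i (fun y => u y 0 i) x + pder i (fun y => a y 0 i) x)
  + (u x 0 i + a x 0 i) * pder i rho x.
have vd i x : is_derive x (delta_mx 0 i) (v i) (dv i x).
  apply: is_derive_mulf; first exact: is_derive_pder.
  by apply: is_derive_addf; apply: is_derive_pder; [apply: (u1 i i).1|apply: (a1 i i).1].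
pose dW i x := D * (phi x * pder i (pder i rho) x + pder i rho x * pder i phi x)
  + - (D * (rho x * pder i (pder i phi) x + pder i phi x * pder i rho x))
  + - (phi x * dv i x + v i x * pder i phi x).
have Wd i x : is_derive x (delta_mx 0 i) (W i) (dW i x).
  have Zd (h : 'rV[R]_d -> R) (dh : R) : is_derive x (delta_mx 0 i) h dh ->
      is_derive x (delta_mx 0 i) (fun y => D * h y) (D * dh).
    by move=> hd; exact: is_deriveZ.
  apply: is_derive_addf; [apply: is_derive_addf|apply: is_derive_oppf].
  - by apply: Zd; apply: is_derive_mulf; exact: is_derive_pder.
  - by apply: is_derive_oppf; apply: Zd; apply: is_derive_mulf; exact: is_derive_pder.
  - by apply: is_derive_mulf => //; exact: is_derive_pder.
have pW i : pder i (W i) = dW i.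
  by apply/funext => x; rewrite /pder (derive_val (is_derive := Wd i x)).
have uic i : continuous (fun x => u x 0 i) by exact: continuous_coord.
have aic i : continuous (fun x => a x 0 i) by exact: continuous_coord.
have vc i : continuous (v i).
  by apply: continuous_mulf => //; exact: continuous_addf.
have dvc i : continuous (dv i).
  apply: continuous_addf; apply: continuous_mulf => //.
    by apply: continuous_addf; [exact: (u1 i i).2|exact: (a1 i i).2].
  exact: continuous_addf.
have Dc : continuous (fun _ : 'rV[R]_d => D) by exact: continuous_cst.
have dWc i : continuous (dW i).
  apply: continuous_addf; [apply: continuous_addf|apply: continuous_oppf].
  - by apply: continuous_mulf => //; apply: continuous_addf; exact: continuous_mulf.
  - apply: continuous_oppf; apply: continuous_mulf => //.
    by apply: continuous_addf; exact: continuous_mulf.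
  - by apply: continuous_addf; exact: continuous_mulf.
have Wc i : continuous (W i).
  apply: continuous_addf; [apply: continuous_addf|apply: continuous_oppf].
  - by apply: continuous_mulf => //; exact: continuous_mulf.
  - by apply: continuous_oppf; apply: continuous_mulf => //; exact: continuous_mulf.
  - exact: continuous_mulf.
have W0 i : torus_integral ell (dW i) = 0.
  rewrite -pW; apply: torus_integral_pder => //.
  - by rewrite pW.
  - move=> j x; rewrite /W /v phiper rhoper uper aper.
    by rewrite !(periodic_pder _ (phiper j)) !(periodic_pder _ (rhoper j)).
have dvE i x : pder i (fun y => (rho y *: (u y + a y)) 0 i) x = dv i x.
  rewrite (_ : (fun y => _) = v i); last by apply/funext => y; rewrite !mxE.
  by rewrite /pder (derive_val (is_derive := vd i x)).
have gc i : continuous (fun x => grad phi x 0 i).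
  by under eq_fun do rewrite mxE; exact: phidc.
have agc i : continuous (fun x => (a x - grad phi x) 0 i).
  under eq_fun do rewrite mxE [X in _ + X]mxE.
  by apply: continuous_addf => //; exact: continuous_oppf.
pose B x := (lagrangian (a x) + f0 x) * rho x.
pose C x := 2^-1 * dotp (a x - grad phi x) (a x - grad phi x) * rho x.
have hc : continuous (fun _ : 'rV[R]_d => 2^-1 : R) by exact: continuous_cst.
have Bc : continuous B.
  apply: continuous_mulf => //; apply: continuous_addf => //.
  by apply: continuous_mulf => //; exact: continuous_dotp.
have Cc : continuous C.
  apply: continuous_mulf => //; apply: continuous_mulf => //.
  exact: continuous_dotp.
(* The right-hand side is written as [a * f + g] twice over, the shape in which [torus_integral_lin]
   applies. *)
have E x : pt x * rho x + phi x * rt x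
    = 1 * ((-1) * C x + B x) + \sum_(i < d) dW i x.
  have -> : pt x = f0 x - 2^-1 * dotp (grad phi x) (grad phi x)
      - dotp (grad phi x) (u x) - D * laplacian phi x by rewrite -hjb; ring.
  have -> : rt x = D * laplacian rho x
      - divergence (fun y => rho y *: (u y + a y)) x by rewrite -tr; ring.
  rewrite /dotp /laplacian /divergence.
  under eq_bigr do rewrite !mxE.
  under [X in _ - X - _]eq_bigr do rewrite !mxE.
  under [X in _ * (_ - X)]eq_bigr do rewrite dvE.
  rewrite (energy_density_identity D (f0 x) (phi x) (rho x) _ (fun i => a x 0 i) _ _ _ _
    (fun i => pder i rho x)); last by rewrite mulfV.
  rewrite /B /C /lagrangian /dotp mul1r mulN1r; congr (_ + _).
  rewrite [RHS]addrC; congr (_ - _); congr (_ * _ * _).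
  by apply: eq_bigr => i _; rewrite !mxE.
under [X in torus_integral _ X = _]eq_fun do rewrite E.
rewrite torus_integral_lin; [|exact: ltW| |exact: continuous_sumf]; last first.
  by apply: continuous_addf => //; apply: continuous_mulf => //; exact: continuous_cst.
by rewrite torus_integral_sum0// torus_integral_lin ?ltW// addr0 mul1r mulN1r addrC.
Qed.

Lemma time_quotient_clamp (R : realType) (t T : R) (f : R -> R) (s l : R) :
  s \in `[t, T] -> time_quotient t T f s --> l ->
  time_quotient t T (fun r => f (clamp t T r)) s --> l.
Proof.
move=> stT fl U /fl; rewrite /time_quotient /fmap/= /within/=.
apply: (@filterS _ (0^')) => h + hin => /(_ hin).
by rewrite /preimage/= !clamp_id.
Qed.

Lemma continuous_slice (R : realType) (d : nat) (Y : topologicalType) (t T : R)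
    (f : R -> 'rV[R]_d -> Y) s : t <= T -> jointly_continuous t T f ->
  s \in `[t, T] -> continuous (f s).
Proof.
move=> tT cf stT; rewrite -(clamp_id stT).
apply: (continuous_compose (f := fun x => (s, x)) _ (continuous_clamp tT cf)).
by apply: continuous_pair; [exact: continuous_cst|move=> x; exact: cvg_id].
Qed.

Lemma C12_C2_torus (R : realType) (d : nat) (ell t T : R)
    (f : R -> 'rV[R]_d -> R) s : t <= T -> C12 ell t T f -> s \in `[t, T] ->
  C2_torus ell (f s).
Proof.
move=> tT [fper fc _ _ fd fdc fd2 fd2c] stT; split.
- exact: fper.
- exact: continuous_slice fc stT.
- by move=> i x; exact: fd.
- by move=> i; exact: continuous_slice (fdc i) stT.
- by move=> i x; exact: fd2.
- by move=> i; exact: continuous_slice (fd2c i i) stT.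
Qed.

(** This is [torus_energy] integrated in time: its left side is the derivative of the integral of
    phi rho, whence the two boundary terms. The continuity statement is kept for the uniqueness
    argument, which has to deduce that the deviation vanishes from its integral. *)
Lemma cost_formula (R : realType) (d : nat) (ell D t T : R)
    (u a : R -> 'rV[R]_d -> 'rV[R]_d) (f phi rho : R -> 'rV[R]_d -> R) :
  0 < ell -> t < T ->
  (forall s, s \in `[t, T] -> on_torus ell (u s)) ->
  (forall s, s \in `[t, T] -> C1_field (u s)) ->
  jointly_continuous t T u ->
  (forall s, s \in `[t, T] -> on_torus ell (a s)) ->
  (forall s, s \in `[t, T] -> C1_field (a s)) ->
  jointly_continuous t T a ->
  C12 ell t T phi -> C12 ell t T rho ->
  hjb_eq D t T u f phi -> transport_eq D t T u a rho ->
  continuous (fun p : R * 'rV[R]_d => 2^-1 *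
    dotp (a (clamp t T p.1) p.2 - grad (phi (clamp t T p.1)) p.2)
         (a (clamp t T p.1) p.2 - grad (phi (clamp t T p.1)) p.2)
    * rho (clamp t T p.1) p.2) /\
  \int[@lebesgue_measure R]_(s in `[t, T])
     torus_integral ell (fun x => (lagrangian (a s x) + f s x) * rho s x)
  = torus_integral ell (fun x => phi T x * rho T x)
    - torus_integral ell (fun x => phi t x * rho t x)
    + \int[@lebesgue_measure R]_(s in `[t, T]) torus_integral ell (fun x =>
        2^-1 * dotp (a s x - grad (phi s) x) (a s x - grad (phi s) x) * rho s x).
Proof.
move=> l0 tT uper u1 uc aper a1 ac phiC rhoC hjb tr.
have tT' := ltW tT.
pose cl := clamp t T.
have clin s : cl s \in `[t, T] by exact: clamp_in.
have cphi := continuous_clamp tT' (C12_cont phiC).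
have crho := continuous_clamp tT' (C12_cont rhoC).
have cphit := continuous_clamp tT' (C12_time_cont phiC).
have crhot := continuous_clamp tT' (C12_time_cont rhoC).
have cgi i : continuous (fun p : R * 'rV[R]_d => grad (phi (cl p.1)) p.2 0 i).
  rewrite (_ : (fun p => _) = fun p : R * 'rV[R]_d => pder i (phi (cl p.1)) p.2).
    exact: (@continuous_clamp R d _ t T (fun s => pder i (phi s)) tT'
      (C12_space_cont phiC (i := i))).
  by apply/funext => p; rewrite mxE.
have cui i : continuous (fun p : R * 'rV[R]_d => u (cl p.1) p.2 0 i).
  apply: (@continuous_coord R _ d (fun p : R * 'rV[R]_d => u (cl p.1) p.2)).
  exact: (continuous_clamp tT' uc).
have cai i : continuous (fun p : R * 'rV[R]_d => a (cl p.1) p.2 0 i).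
  apply: (@continuous_coord R _ d (fun p : R * 'rV[R]_d => a (cl p.1) p.2)).
  exact: (continuous_clamp tT' ac).
have cst2 : continuous (fun _ : R * 'rV[R]_d => 2^-1 : R) by exact: continuous_cst.
(* No continuity of [f] is assumed; the Hamilton-Jacobi equation writes it as a sum of continuous
   terms. *)
have cf : continuous (fun p : R * 'rV[R]_d => f (cl p.1) p.2).
  rewrite (_ : (fun p => _) = fun p : R * 'rV[R]_d =>
      time_deriv t T (phi ^~ p.2) (cl p.1)
      + 2^-1 * dotp (grad (phi (cl p.1)) p.2) (grad (phi (cl p.1)) p.2)
      + dotp (grad (phi (cl p.1)) p.2) (u (cl p.1) p.2)
      + D * laplacian (phi (cl p.1)) p.2); last first.
    by apply/funext => p; rewrite hjb.
  apply: continuous_addf; first apply: continuous_addf; first apply: continuous_addf.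
  - exact: cphit.
  - by apply: continuous_mulf => //; exact: continuous_dotp.
  - exact: continuous_dotp.
  - apply: continuous_mulf; first exact: continuous_cst.
    apply: continuous_sumf => i.
    exact: (@continuous_clamp R d _ t T (fun s => pder i (pder i (phi s))) tT'
      (C12_space2_cont phiC (i := i) (j := i))).
pose A s x := time_deriv t T (phi ^~ x) s * rho s x
  + phi s x * time_deriv t T (rho ^~ x) s.
pose B s x := (lagrangian (a s x) + f s x) * rho s x.
pose C s x :=
  2^-1 * dotp (a s x - grad (phi s) x) (a s x - grad (phi s) x) * rho s x.
have cA : continuous (fun p : R * 'rV[R]_d => A (cl p.1) p.2).
  by apply: continuous_addf; exact: continuous_mulf.
have cB : continuous (fun p : R * 'rV[R]_d => B (cl p.1) p.2).
  apply: continuous_mulf => //; apply: continuous_addf => //.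
  by apply: continuous_mulf => //; exact: continuous_dotp.
have cC : continuous (fun p : R * 'rV[R]_d => C (cl p.1) p.2).
  apply: continuous_mulf => //; apply: continuous_mulf => //.
  have cagi i : continuous (fun p : R * 'rV[R]_d =>
      (a (cl p.1) p.2 - grad (phi (cl p.1)) p.2) 0 i).
    under eq_fun do rewrite mxE [X in _ + X]mxE.
    by apply: continuous_addf => //; exact: continuous_oppf.
  exact: continuous_dotp.
split=> //.
have TIc (h : R -> 'rV[R]_d -> R) :
    continuous (fun p : R * 'rV[R]_d => h (cl p.1) p.2) ->
    continuous (fun s => torus_integral ell (h (cl s))).
  by move=> ch; exact: (torus_integral_continuous (ltW l0) (f := fun s => h (cl s))).
pose P s x := phi s x * rho s x.
have cP : continuous (fun p : R * 'rV[R]_d => P (cl p.1) p.2) by exact: continuous_mulf.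
(* Strictly inside []t, T[] the quotients are two-sided and the clamp is harmless; at [t] and [T]
   the fundamental theorem asks for continuity only. *)
have dP s x : s \in `]t, T[ -> is_derive s 1 (fun r => P (cl r) x) (A (cl s) x).
  move=> soo; have stT : s \in `[t, T] by exact: subset_itv_oo_cc soo.
  have dq (h : R -> 'rV[R]_d -> R) : C12 ell t T h ->
      is_derive s 1 (fun r => h (cl r) x) (time_deriv t T (h ^~ x) s).
    move=> hC; apply: (@time_quotient_derive R t T (fun r => h (cl r) x) s _ soo).
    have hx : time_derivable t T (h ^~ x) s by exact: (C12_time hC).
    have := @time_quotient_clamp R t T (h ^~ x) s _ stT hx; exact.
  have := is_derive_mulf (dq _ phiC) (dq _ rhoC).
  by rewrite /A /cl (clamp_id stT) addrC mulrC.
have FTC : \int[@lebesgue_measure R]_(s in `[t, T]) torus_integral ell (A (cl s))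
    = torus_integral ell (P T) - torus_integral ell (P t).
  rewrite (Rintegral_FTC2 tT (TIc _ cA) (TIc _ cP)
    (@torus_integral_derive R ell d (fun s => P (cl s)) (fun s => A (cl s)) t T
      (ltW l0) cP cA dP)).
  by rewrite /cl !clamp_id// in_itv/= lexx tT'.
have slice (h : R -> 'rV[R]_d -> R) s :
    continuous (fun p : R * 'rV[R]_d => h (cl p.1) p.2) -> continuous (h (cl s)).
  move=> ch; apply: (continuous_compose (f := fun x => (s, x)) _ ch).
  by apply: continuous_pair; [exact: continuous_cst|move=> x; exact: cvg_id].
have energy s : torus_integral ell (A (cl s))
    = torus_integral ell (B (cl s)) - torus_integral ell (C (cl s)).
  apply: (torus_energy l0 (C12_C2_torus tT' phiC (clin s))
    (C12_C2_torus tT' rhoC (clin s)) (uper _ (clin s)) (aper _ (clin s))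
    (u1 _ (clin s)) (a1 _ (clin s))).
  - exact: slice.
  - by move=> x; exact: hjb.
  - by move=> x; exact: tr.
have unclamp (h : R -> 'rV[R]_d -> R) :
    \int[@lebesgue_measure R]_(s in `[t, T]) torus_integral ell (h s)
    = \int[@lebesgue_measure R]_(s in `[t, T]) torus_integral ell (h (cl s)).
  by apply: eq_Rintegral => s; rewrite inE/= => stT; rewrite /cl clamp_id.
rewrite (unclamp B) (unclamp C) -/(P T) -FTC.
rewrite -RintegralD//; [|exact: continuous_integrable_itv (TIc _ _)..].
by apply: eq_Rintegral => s _; rewrite energy subrK.
Qed.

(** * Optimality and uniqueness *)

Lemma grad_jointly_continuous (R : realType) (d : nat) (ell t T : R)
    (phi : R -> 'rV[R]_d -> R) :
  C12 ell t T phi -> jointly_continuous t T (fun s => grad (phi s)).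
Proof.
move=> phiC p; apply: cvg_mx => i j; rewrite mxE.
rewrite (_ : (fun p' => _) = fun p' : R * 'rV[R]_d => pder j (phi p'.1) p'.2).
  exact: (@C12_space_cont _ _ _ _ _ _ phiC j).
by apply/funext => p'; rewrite mxE.
Qed.

(** The mixed second derivatives in [C12] serve here: a control must be C1 in space, and grad phi
    has to qualify as one. *)
Lemma grad_C1 (R : realType) (d : nat) (ell t T : R)
    (phi : R -> 'rV[R]_d -> R) s : t <= T ->
  C12 ell t T phi -> s \in `[t, T] -> C1_field (grad (phi s)).
Proof.
move=> tT phiC stT; split.
  exact: (continuous_slice tT (grad_jointly_continuous phiC) stT).
move=> i j.
have -> : (fun y => grad (phi s) y 0 j) = pder j (phi s).
  by apply/funext => y; rewrite mxE.
split; first by move=> x; exact: (C12_space2 phiC).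
exact: (@continuous_slice R d _ t T (fun s => pder i (pder j (phi s))) s tT
  (@C12_space2_cont _ _ _ _ _ _ phiC j i) stT).
Qed.

Lemma grad_on_torus (R : realType) (d : nat) (ell : R) (f : 'rV[R]_d -> R) :
  on_torus ell f -> on_torus ell (grad f).
Proof. by move=> fper i x; apply/rowP => j; rewrite !mxE periodic_pder. Qed.

(** Since div u = 0, expanding the divergence gives (u + grad phi) . grad r + r Delta phi. The
    coefficient Delta phi is continuous and so attains a minimum over [[t, T]] times the cell; minus
    this minimum is the constant [K] of the minimum principle. *)
Lemma transport_ge0 (R : realType) (d : nat) (ell D t T : R)
    (u : R -> 'rV[R]_d -> 'rV[R]_d) (phi r rt : R -> 'rV[R]_d -> R) :
  0 < ell -> 0 <= D -> t < T -> C12 ell t T phi ->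
  (forall s, s \in `[t, T] -> C1_field (u s)) ->
  (forall s x, s \in `[t, T] -> divergence (u s) x = 0) ->
  (forall s, s \in `[t, T] -> on_torus ell (r s)) ->
  jointly_continuous t T r ->
  (forall s x, s \in `[t, T] -> time_quotient t T (r ^~ x) s --> rt s x) ->
  (forall s x i, s \in `[t, T] -> derivable (r s) x (delta_mx 0 i)) ->
  (forall s x i, s \in `[t, T] -> derivable (pder i (r s)) x (delta_mx 0 i)) ->
  (forall s x, s \in `[t, T] ->
    rt s x + divergence (fun y => r s y *: (u s y + grad (phi s) y)) x
    = D * laplacian (r s) x) ->
  (forall x, 0 <= r t x) -> forall s x, s \in `[t, T] -> 0 <= r s x.
Proof.
move=> l0 D0 tT phiC u1 udiv rper rc rtime dr ddr eqn r0.
have tT' := ltW tT.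
have lapc : continuous (fun p : R * 'rV[R]_d => laplacian (phi (clamp t T p.1)) p.2).
  apply: continuous_sumf => i.
  exact: (@continuous_clamp R d _ t T (fun s => pder i (pder i (phi s))) tT'
    (@C12_space2_cont _ _ _ _ _ _ phiC i i)).
have [||c _ cmin] := @compact_EVT_min _ R _ (`[t, T]%classic `*` @cell R ell d)
  _ _ (continuous_subspaceT lapc).
- exists (t, 0); split; first by rewrite /= in_itv/= lexx.
  exact/cell0/ltW.
- by apply: compact_setX; [exact: segment_compact|exact: cell_compact].
apply: (@minimum_principle R d ell D t T
  (- laplacian (phi (clamp t T c.1)) c.2) r rt (fun s x => laplacian (phi s) x)
  (fun s x i => u s x 0 i + grad (phi s) x 0 i)) => //.
- move=> s x stT xc; rewrite opprK.
  have := cmin (s, x); rewrite /= (clamp_id stT); apply.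
  by rewrite inE.
move=> s x stT; rewrite -eqn// -addrA; congr (_ + _).
have -> : laplacian (phi s) x = divergence (u s) x + laplacian (phi s) x.
  by rewrite udiv// add0r.
rewrite /divergence /laplacian -big_split/= mulr_suml -big_split/=.
apply: eq_bigr => i _; rewrite [in RHS]/pder; symmetry; apply: derive_val.
rewrite (_ : (fun y => _) = fun y => r s y * (u s y 0 i + pder i (phi s) y)); last first.
  by apply/funext => y; rewrite !mxE.
rewrite mxE addrC [X in X + _]mulrC.
apply: is_derive_mulf; first exact/is_derive_pder/dr.
apply: is_derive_addf; apply: is_derive_pder; first exact: ((u1 s stT).2 i i).1.
exact: (C12_space2 phiC).
Qed.

(** With the drift fixed the equation is linear, so [r2 - r1] solves it with zero initial datum and
    is nonnegative. One inequality is enough, as the two solutions can be exchanged. *)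
Lemma transport_unique (R : realType) (d : nat) (ell D t T : R)
    (u : R -> 'rV[R]_d -> 'rV[R]_d) (phi r1 r2 : R -> 'rV[R]_d -> R) :
  0 < ell -> 0 <= D -> t < T -> C12 ell t T phi ->
  (forall s, s \in `[t, T] -> C1_field (u s)) ->
  (forall s x, s \in `[t, T] -> divergence (u s) x = 0) ->
  C12 ell t T r1 -> C12 ell t T r2 ->
  transport_eq D t T u (fun s => grad (phi s)) r1 ->
  transport_eq D t T u (fun s => grad (phi s)) r2 ->
  (forall x, r1 t x = r2 t x) -> forall s x, s \in `[t, T] -> r1 s x <= r2 s x.
Proof.
move=> l0 D0 tT phiC u1 udiv C1 C2 eq1 eq2 init s x stT.
rewrite -subr_ge0; move: s x stT.
have pderB s x i : s \in `[t, T] ->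
    is_derive x (delta_mx 0 i) (fun y => r2 s y - r1 s y)
      (pder i (r2 s) x - pder i (r1 s) x).
  move=> stT; apply: is_derive_addf; first exact/is_derive_pder/(C12_space C2).
  by apply: is_derive_oppf; exact/is_derive_pder/(C12_space C1).
have pderBE s i : s \in `[t, T] ->
    pder i (fun y => r2 s y - r1 s y) = fun x => pder i (r2 s) x - pder i (r1 s) x.
  move=> stT; apply/funext => x.
  by rewrite /pder (derive_val (is_derive := pderB s x i stT)).
have pder2B s x i : s \in `[t, T] ->
    is_derive x (delta_mx 0 i) (fun y => pder i (r2 s) y - pder i (r1 s) y)
      (pder i (pder i (r2 s)) x - pder i (pder i (r1 s)) x).
  move=> stT; apply: is_derive_addf; first exact/is_derive_pder/(C12_space2 C2).
  by apply: is_derive_oppf; exact/is_derive_pder/(C12_space2 C1).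
apply: (@transport_ge0 R d ell D t T u phi (fun s x => r2 s x - r1 s x)
  (fun s x => time_deriv t T (r2 ^~ x) s - time_deriv t T (r1 ^~ x) s)
  l0 D0 tT phiC u1 udiv).
- by move=> s stT i x; rewrite (C12_torus C1 stT) (C12_torus C2 stT).
- by move=> p; apply: cvgB; [exact: (C12_cont C2)|exact: (C12_cont C1)].
- move=> s x stT; rewrite /time_quotient.
  have h1 : time_derivable t T (r1 ^~ x) s by exact: (C12_time C1).
  have h2 : time_derivable t T (r2 ^~ x) s by exact: (C12_time C2).
  rewrite (_ : (fun h : R => _) = fun h => h^-1 * (r2 (s + h) x - r2 s x)
      - h^-1 * (r1 (s + h) x - r1 s x)).
    by apply: cvgB; [exact: h2|exact: h1].
  by apply/funext => h; ring.
- by move=> s x i stT; have [] := pderB s x i stT.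
- by move=> s x i stT; rewrite pderBE//; have [] := pder2B s x i stT.
- move=> s x stT.
  have -> : laplacian (fun y => r2 s y - r1 s y) x
      = laplacian (r2 s) x - laplacian (r1 s) x.
    rewrite /laplacian -sumrB; apply: eq_bigr => i _.
    by rewrite pderBE// {1}/pder (derive_val (is_derive := pder2B s x i stT)).
  have dvd (r : R -> 'rV[R]_d -> R) i : C12 ell t T r ->
      derivable (fun y => (r s y *: (u s y + grad (phi s) y)) 0 i) x (delta_mx 0 i).
    move=> rC.
    rewrite (_ : (fun y => _) = fun y => r s y * (u s y 0 i + pder i (phi s) y)); last first.
      by apply/funext => y; rewrite !mxE.
    apply: derivableM; first exact: (C12_space rC).
    apply: derivableD; first exact: ((u1 s stT).2 i i).1.
    exact: (C12_space2 phiC).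
  have -> : divergence (fun y => (r2 s y - r1 s y) *: (u s y + grad (phi s) y)) x
      = divergence (fun y => r2 s y *: (u s y + grad (phi s) y)) x
        - divergence (fun y => r1 s y *: (u s y + grad (phi s) y)) x.
    rewrite /divergence -sumrB; apply: eq_bigr => i _.
    have dvB := is_derive_addf (is_derive_pder (dvd r2 i C2))
      (is_derive_oppf (is_derive_pder (dvd r1 i C1))).
    rewrite -(derive_val (is_derive := dvB)) /pder; congr (derive _ _ _).
    by apply/funext => y; rewrite !mxE mulrBl.
  move: (eq1 s x stT) (eq2 s x stT).
  generalize (laplacian (r1 s) x) (laplacian (r2 s) x)
    (divergence (fun y => r1 s y *: (u s y + grad (phi s) y)) x)
    (divergence (fun y => r2 s y *: (u s y + grad (phi s) y)) x)
    (time_deriv t T (r1 ^~ x) s) (time_deriv t T (r2 ^~ x) s).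
  by move=> L1 L2 d1 d2 p1 p2 e1 e2; rewrite mulrBr -e1 -e2; ring.
- by move=> x; rewrite init subrr.
Qed.

Lemma torus_integralN (R : realType) (ell : R) (d : nat) (f : 'rV[R]_d -> R) :
  0 <= ell -> continuous f -> torus_integral ell (fun x => - f x) = - torus_integral ell f.
Proof.
(* Writing - f as - 2 f + f fits the shape [a * f + g]. *)
move=> l0 cf; have := torus_integral_lin (- 2) l0 cf cf.
rewrite (_ : (fun x => - 2 * f x + f x) = fun x => - f x) => [->|]; first by ring.
by apply/funext => x; ring.
Qed.

Lemma dotp_ge0 (R : realType) (d : nat) (v : 'rV[R]_d) : 0 <= dotp v v.
Proof. by apply: sumr_ge0 => i _; rewrite -expr2 sqr_ge0. Qed.

Lemma dotp_eq0 (R : realType) (d : nat) (v : 'rV[R]_d) : dotp v v = 0 -> v = 0.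
Proof.
move=> /eqP; rewrite psumr_eq0; last by move=> i _; rewrite -expr2 sqr_ge0.
move=> /allP v0; apply/rowP => i; rewrite mxE.
by have := v0 i (mem_index_enum _); rewrite mulf_eq0 orbb => /eqP.
Qed.


Theorem proposition1 (R : realType) (d : nat) (hd : (0 < d <= 2)%N)
  (ell : R) (hell : 0 < ell)
  (D : R) (hD : 0 <= D)
  (t T : R) (htT : t < T)
  (V : set ('rV[R]_d -> R)) (W : set ('rV[R]_d -> 'rV[R]_d))
  (Tau : ('rV[R]_d -> R) -> ('rV[R]_d -> 'rV[R]_d))
  (hTau : velocity_operator ell V W Tau)
  (F G : 'rV[R]_d -> ('rV[R]_d -> R) -> R)
  (hF : forall p, V p -> on_torus ell (F ^~ p))
  (hG : forall p, V p -> on_torus ell (G ^~ p))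
  (q : R -> 'rV[R]_d -> R)
  (hq : forall s, s \in `[t, T] -> V (q s))
  (hu : jointly_continuous t T (fun s => Tau (q s)))
  (rho0 : 'rV[R]_d -> R) (hrho0 : forall x, 0 <= rho0 x)
  (rho phi : R -> 'rV[R]_d -> R)
  (hmfg : mfg1_system ell D t T Tau F G q rho0 rho phi) :
  optimal ell D t T Tau F G q rho0 rho (fun s => grad (phi s)) /\
  (forall (rho' : R -> 'rV[R]_d -> R) (alpha' : R -> 'rV[R]_d -> 'rV[R]_d),
     optimal ell D t T Tau F G q rho0 rho' alpha' ->
     forall (s : R) (x : 'rV[R]_d), s \in `[t, T] ->
       rho' s x = rho s x /\ (0 < rho s x -> alpha' s x = grad (phi s) x)).
Proof.
case: hmfg => rhoC phiC tr init hjb term.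
have tT := ltW htT.
have TtT : T \in `[t, T] by rewrite in_itv/= lexx tT.
have ttT : t \in `[t, T] by rewrite in_itv/= lexx tT.
have Wu s : s \in `[t, T] -> W (Tau (q s)).
  by move=> stT; case: (vel_bij hTau) => TW _ _; apply: TW; exact: hq.
have uper s : s \in `[t, T] -> on_torus ell (Tau (q s)).
  by move=> stT; exact: (vel_W_torus hTau (Wu s stT)).
have u1 s : s \in `[t, T] -> C1_field (Tau (q s)).
  by move=> stT; exact: (vel_W_C1 hTau (Wu s stT)).
have udiv s x : s \in `[t, T] -> divergence (Tau (q s)) x = 0.
  by move=> stT; exact: (vel_div0 hTau (hq s stT)).
have gper s : s \in `[t, T] -> on_torus ell (grad (phi s)).
  by move=> stT; exact/grad_on_torus/(C12_torus phiC).
pose dev (r : R -> 'rV[R]_d -> R) (a : R -> 'rV[R]_d -> 'rV[R]_d) s x :=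
  2^-1 * dotp (a s x - grad (phi s) x) (a s x - grad (phi s) x) * r s x.
have dev_ge0 r a s x : admissible ell D t T Tau q rho0 r a -> s \in `[t, T] ->
    0 <= dev r a s x.
  move=> adm stT; rewrite mulr_ge0 ?(adm_rho_ge0 adm)//.
  by rewrite mulr_ge0 ?dotp_ge0 ?invr_ge0.
pose c0 := - torus_integral ell (fun x => phi t x * rho0 x).
have costE r a : admissible ell D t T Tau q rho0 r a ->
    continuous (fun p : R * 'rV[R]_d => dev r a (clamp t T p.1) p.2) /\
    cost ell t T F G q r a =
      c0 + \int[@lebesgue_measure R]_(s in `[t, T]) torus_integral ell (dev r a s).
  case=> rC r0 aper a1 ac rtr rinit.
  have [cdev E] := cost_formula hell htT uper u1 hu aper a1 ac phiC rC hjb rtr.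
  split => //; rewrite /cost E /c0.
  (* By the terminal condition the terminal cost is minus the boundary term at [T], so the two
     cancel; the boundary term at [t] involves [rho0] alone and is common to all admissible
     pairs. *)
  have -> : (fun x => G x (q T) * r T x) = fun x => - (phi T x * r T x).
    by apply/funext => x; rewrite term mulNr opprK.
  have -> : (fun x => phi t x * r t x) = fun x => phi t x * rho0 x.
    by apply/funext => x; rewrite rinit.
  rewrite torus_integralN ?ltW//; last first.
    apply: continuous_mulf; last exact: (continuous_slice tT (C12_cont rC) TtT).
    exact: (continuous_slice tT (C12_cont phiC) TtT).
  by rewrite addrA addrA addNr add0r.
have adm : admissible ell D t T Tau q rho0 rho (fun s => grad (phi s)).
  split => //.
  - apply: (@transport_ge0 R d ell D t T (fun s => Tau (q s)) phi rho
      (fun s x => time_deriv t T (rho ^~ x) s)) => //.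
    + exact: (C12_torus rhoC).
    + exact: (C12_cont rhoC).
    + by move=> s x stT; exact: (C12_time rhoC).
    + by move=> s x i stT; exact: (C12_space rhoC).
    + by move=> s x i stT; exact: (C12_space2 rhoC).
    + by move=> x; rewrite init.
  - by move=> s stT; exact: grad_C1 phiC stT.
  - exact: grad_jointly_continuous phiC.
have cost_rho : cost ell t T F G q rho (fun s => grad (phi s)) = c0.
  rewrite (costE _ _ adm).2 -[RHS]addr0; congr (_ + _).
  rewrite [LHS](@eq_Rintegral _ _ _ _ _ (cst 0)).
    by rewrite Rintegral_cst_itv// mul0r.
  move=> s _; rewrite -[RHS](@torus_integral0 R ell d (ltW hell)).
  f_equal; apply/funext => x; rewrite /dev subrr /dotp big1 ?mulr0 ?mul0r//.
  by move=> i _; rewrite mxE mul0r.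
have intdev_ge0 r a : admissible ell D t T Tau q rho0 r a ->
    0 <= \int[@lebesgue_measure R]_(s in `[t, T]) torus_integral ell (dev r a s).
  move=> radm; apply: fine_ge0; apply: integral_ge0 => s stT.
  by rewrite lee_fin; apply: torus_integral_ge0 => x; exact: dev_ge0.
have valueE : value ell D T Tau F G q rho0 t = c0%:E.
  apply/eqP; rewrite eq_le; apply/andP; split.
    by apply: ereal_inf_lbound; exists rho, (fun s => grad (phi s)); rewrite cost_rho.
  apply: le_ereal_inf_tmp => _ [r [a [radm ->]]].
  by rewrite lee_fin (costE _ _ radm).2 lerDl intdev_ge0.
split; first by split=> //; rewrite cost_rho valueE.
move=> r a [radm]; rewrite valueE => -[].
have [cdev ->] := costE _ _ radm.
move=> /(canRL (addKr _)); rewrite addNr => int0.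
(* Vanishing passes from the time integral to each time, endpoints included, then to each point of
   the cell, then to all [x] by periodicity. Nonnegativity and continuity exclude exceptional null
   sets at both integrations. *)
have dev0 s x : s \in `[t, T] -> dev r a s x = 0.
  move=> stT.
  have cdevs : continuous (fun s => torus_integral ell (dev r a (clamp t T s))).
    exact: (torus_integral_continuous (ltW hell)
      (f := fun s => dev r a (clamp t T s)) cdev).
  have TI0 : torus_integral ell (dev r a s) = 0.
    rewrite -(clamp_id stT); apply: (Rintegral_itv_eq0 htT cdevs) => //.
      by move=> s' _; apply: torus_integral_ge0 => y; apply: dev_ge0 => //; exact: clamp_in.
    rewrite -[RHS]int0; apply: eq_Rintegral => s'; rewrite inE/= => s'tT.
    by rewrite clamp_id.
  have devper : on_torus ell (dev r a s).
    move=> i y; rewrite /dev (adm_alpha_torus radm)// gper//.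
    by rewrite (C12_torus (adm_rho_C12 radm)).
  have [y yc ->//] := cell_repr x hell.
  apply: (torus_integral_eq0 hell _ _ TI0) yc => [|z]; last exact: dev_ge0.
  rewrite -(clamp_id stT).
  apply: (continuous_compose (f := fun x => (s, x)) _ cdev).
  by apply: continuous_pair; [exact: continuous_cst|move=> z; exact: cvg_id].
(* Where the density is zero the controls may differ, but both fluxes vanish. Equality of fluxes
   therefore holds everywhere, and the transport equation sees the control only through the flux. *)
have flux s x : s \in `[t, T] -> r s x *: a s x = r s x *: grad (phi s) x.
  move=> stT; have /eqP := dev0 s x stT.
  rewrite !mulf_eq0 invr_eq0 pnatr_eq0/= => /orP[/eqP/dotp_eq0|/eqP ->].
    by move=> /eqP; rewrite subr_eq0 => /eqP ->.
  by rewrite !scale0r.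
have rtr : transport_eq D t T (fun s => Tau (q s)) (fun s => grad (phi s)) r.
  move=> s x stT; rewrite -(adm_transport radm)//; congr (_ + divergence _ x).
  by apply/funext => y; rewrite !scalerDr flux.
have rE s x : s \in `[t, T] -> r s x = rho s x.
  have rC := adm_rho_C12 radm.
  have initE y : r t y = rho t y by rewrite (adm_init radm) init.
  move=> stT; apply/eqP; rewrite eq_le.
  rewrite (transport_unique hell hD htT phiC u1 udiv rC rhoC rtr tr)//=.
  by rewrite (transport_unique hell hD htT phiC u1 udiv rhoC rC tr rtr).
move=> s x stT; split; first exact: rE.
rewrite -rE// => r0; apply: (@scalerI _ _ (r s x)); first by rewrite gt_eqF.
exact: flux.
Qed.
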